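(* Let $k$ be a field, let $\mathcal{C}$ be a modular category over $k$, and let $A$ be an algebra in $\mathcal{C}$. Then the full centre of $A$ is given by $$Z(A)=C_l\bigl(\iota_+(A)\otimes\tilde R\bigr),$$ where $\tilde R=\int^{Y}Y^{\vee}\boxtimes Y\in\mathcal{C}\boxtimes\mathcal{C}\simeq\mathcal{Z}(\mathcal{C})$ (equivalently $\tilde R=\int^{Y}\iota_+(Y^\vee)\otimes\iota_-(Y)$ in $\mathcal{Z}(\mathcal{C})$) and $C_l$ denotes the left centre of an algebra in the braided monoidal category $\mathcal{Z}(\mathcal{C})$.
   Context: All categories are $k$-linear with finite-dimensional hom-spaces, tensor products are bilinear, monoidal categories are treated as strict; algebras are associative unital. Monoidal centre: $\mathcal{Z}(\mathcal{C})$ is the category of pairs $(Z,z)$ with $Z\in\mathcal{C}$ and $z_X:Z\otimes X\to X\otimes Z$ natural isomorphisms with $z_I=1$, $z_{X\otimes Y}=(X\otimes z_Y)(z_X\otimes Y)$; morphisms are morphisms in $\mathcal{C}$ compatible with half-braidings; $(Z,z)\otimes(W,w)=(Z\otimes W,z|w)$, $(z|w)_X=(z_X\otimes W)(Z\otimes w_X)$; braiding $c_{(X,x),(Y,y)}=x_Y$. Full centre $Z(A)$: the terminal object of the category of pairs $(Z,\zeta)$, $(Z,z)\in\mathcal{Z}(\mathcal{C})$, $\zeta:Z\to A$ in $\mathcal{C}$ with $\mu(\zeta\otimes A)=\mu(A\otimes\zeta)z_A$; it is an algebra in $\mathcal{Z}(\mathcal{C})$ with the unique structure making $Z(A)\to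 A$ an algebra homomorphism. Left centre $C_l(B)$ of an algebra $B$ in a braided monoidal category $\mathcal{D}$ with braiding $c$: the terminal object in the category of morphisms $y:Y\to B$ in $\mathcal{D}$ with $\mu(y\otimes B)=\mu(B\otimes y)c_{Y,B}$; it has the unique algebra structure making $C_l(B)\to B$ a homomorphism. For braided $\mathcal{C}$ there are braided functors $\iota_+(X)=(X,c_{X,-})$ and $\iota_-(X)=(X,c_{-,X}^{-1})$ from $\mathcal{C}$ to $\mathcal{Z}(\mathcal{C})$ (the second with respect to the opposite braiding on $\mathcal{C}$), and a functor $\mathcal{C}\boxtimes\mathcal{C}\to\mathcal{Z}(\mathcal{C})$, $X\boxtimes Y\mapsto\iota_+(X)\otimes\iota_-(Y)$, where $\boxtimes$ is the Deligne tensor product. $\mathcal{C}$ is non-degenerate if this functor is an equivalence. A modular category is a semisimple rigid braided ribbon monoidal category which is non-degenerate. The ($k$-linear) coend $\tilde R$ is then $\bigoplus_{Y\in \mathrm{Irr}(\mathcal{C})}Y^\vee\boxtimes Y$, the sum over representatives of isomorphism classes of simple objects. The algebra structure on $\iota_+(A)\otimes\tilde R$: the tensor product functor $T:\mathcal{C}\boxtimes\mathcal{C}\to\mathcal{C}$, which corresponds to the forgetful functor $F:\mathcal{Z}(\mathcal{C})\to\mathcal{C}$ under the equivalence above, has the right adjoint $R(X)=(X\boxtimes I)\otimes\tilde R$. As right adjoint of a strong monoidal functor, $R$ is lax monoidal, so it sends the algebra $A$ to an algebra $R(A)$, whose underlying object is $\iota_+(A)\otimes\tilde R$. *)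

(* Defs.v *)
From HB Require Import structures.
From mathcomp Require Import all_boot all_order all_algebra.
From mathcomp Require Import boolp.

Set Implicit Arguments.
Unset Strict Implicit.
Unset Printing Implicit Defensive.

Import GRing.Theory VectorInternalTheory.
Local Open Scope ring_scope.

Lemma linear_pred0 (k : fieldType) (U V : lmodType k) (F : U -> V) : linear F -> F 0 = 0.
Proof. by move=> FL; have := FL (-1) 0 0; rewrite scaler0 addr0 scaleN1r addNr. Qed.
Lemma linear_predD (k : fieldType) (U V : lmodType k) (F : U -> V) u v :
  linear F -> F (u + v) = F u + F v.
Proof. by move=> FL; have := FL 1 u v; rewrite !scale1r. Qed.

Section VspaceOfPred.
Variables (k : fieldType) (V : vectType k) (P : V -> Prop).
Hypothesis P0 : P 0.
Hypothesis PL : forall a u v, P u -> P v -> P (a *: u + v).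

Lemma vspace_of_pred_ex : exists U : {vspace V}, forall v, v \in U <-> P v.
Proof.
pose Q n := `[< exists2 U : {vspace V}, \dim U = n & forall v, v \in U -> P v >].
have exQ : exists n, Q n.
  by exists 0%N; apply/asboolP; exists 0%VS; rewrite ?dimv0 // => v; rewrite memv0 => /eqP->.
have ubQ n : Q n -> (n <= \dim {:V})%N.
  by move/asboolP=> [U <- _]; apply/dimvS/subvf.
case: (ex_maxnP exQ ubQ) => n /asboolP[U dU UP] maxn.
exists U => v; split; first exact: UP.
move=> Pv; have /maxn : Q (\dim (<[v]> + U)).
  apply/asboolP; exists (<[v]> + U)%VS => // w /memv_addP[_ /vlineP[a ->]] [u uU ->].
  by apply: PL => //; apply: UP.
rewrite -dU => le_d; have := memv_add (memv_line v) (mem0v U).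
rewrite addr0 => vin; suff -> : U = (<[v]> + U)%VS by [].
by apply/eqP; rewrite eqEdim addvSr.
Qed.

Definition vspace_of_pred : {vspace V} := sval (cid vspace_of_pred_ex).

Lemma vspace_of_predP v : v \in vspace_of_pred <-> P v.
Proof. exact: (svalP (cid vspace_of_pred_ex)). Qed.
End VspaceOfPred.

Definition famv (k : fieldType) n (V : 'I_n -> vectType k) := {dffun forall i, V i}.

Section Fam.
Variables (k : fieldType) (n : nat) (V : 'I_n -> vectType k).
Implicit Types f g : famv V.
HB.instance Definition _ := Choice.on (famv V).
Definition fam_zero : famv V := [ffun i => 0].
Definition fam_opp f : famv V := [ffun i => - f i].
Definition fam_add f g : famv V := [ffun i => f i + g i].
Definition fam_scale (a : k) f : famv V := [ffun i => a *: f i].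
Fact fam_addA : associative fam_add.
Proof. by move=> f g h; apply/ffunP=> i; rewrite !ffunE addrA. Qed.
Fact fam_addC : commutative fam_add.
Proof. by move=> f g; apply/ffunP=> i; rewrite !ffunE addrC. Qed.
Fact fam_add0 : left_id fam_zero fam_add.
Proof. by move=> f; apply/ffunP=> i; rewrite !ffunE add0r. Qed.
Fact fam_addN : left_inverse fam_zero fam_opp fam_add.
Proof. by move=> f; apply/ffunP=> i; rewrite !ffunE addNr. Qed.
HB.instance Definition _ :=
  GRing.isZmodule.Build (famv V) fam_addA fam_addC fam_add0 fam_addN.
Fact fam_scaleA a b f : fam_scale a (fam_scale b f) = fam_scale (a * b) f.
Proof. by apply/ffunP=> i; rewrite !ffunE scalerA. Qed.
Fact fam_scale1 : left_id 1 fam_scale.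
Proof. by move=> f; apply/ffunP=> i; rewrite !ffunE scale1r. Qed.
Fact fam_scaleDr : right_distributive fam_scale +%R.
Proof. by move=> a f g; apply/ffunP=> i; rewrite !ffunE scalerDr. Qed.
Fact fam_scaleDl f : {morph fam_scale^~ f : a b / a + b}.
Proof. by move=> a b; apply/ffunP=> i; rewrite !ffunE scalerDl. Qed.
HB.instance Definition _ := GRing.Zmodule_isLmodule.Build k (famv V)
  fam_scaleA fam_scale1 fam_scaleDr fam_scaleDl.

Fact fam_vect_iso : Vector.axiom (\sum_i dim (V i)) (famv V).
Proof.
exists (fun f => \mxrow_i v2r (f i)).
  move=> a f g; apply/mxrowP => i.
  have sZ A : submxrow (a *: A) i = a *: submxrow A i.
    by apply/matrixP=> x y; rewrite !mxE.
  by rewrite submxrowD sZ !mxrowK ffunE ffunE linearP.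
exists (fun r => [ffun i => r2v (submxrow r i)] : famv V) => [f|r].
  by apply/ffunP=> i; rewrite ffunE mxrowK v2rK.
by apply/mxrowP=> i; rewrite mxrowK ffunE r2vK.
Qed.
HB.instance Definition _ := Lmodule_hasFinDim.Build k (famv V) fam_vect_iso.

Lemma fam_sumE (J : finType) (F : J -> famv V) i : (\sum_j F j) i = \sum_j F j i.
Proof. by elim/big_rec2: _ => [|j x y _ <-]; rewrite ffunE. Qed.
Lemma fam_linE a f g i : (a *: f + g) i = a *: f i + g i.
Proof. by rewrite !ffunE. Qed.
End Fam.

(* Tensor product of two finite-dimensional spaces: coordinates in the
   tensor product of the two coordinate bases. *)
Definition tens (k : fieldType) (U V : vectType k) : vectType k :=
  'M[k]_(dim U, dim V).

Section Tens.
Variables (k : fieldType) (U V : vectType k).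

Definition pure (u : U) (v : V) : tens U V := (v2r u)^T *m v2r v.

Definition tlift (W : vectType k) (b : U -> V -> W) (t : tens U V) : W :=
  \sum_i \sum_j (t : 'M[k]_(_, _)) i j *:
     b (r2v (delta_mx 0 i)) (r2v (delta_mx 0 j)).

Lemma pure_linl a u u' v : pure (a *: u + u') v = a *: pure u v + pure u' v.
Proof. by rewrite /pure linearP /= linearP /= mulmxDl scalemxAl. Qed.
Lemma pure_linr a u v v' : pure u (a *: v + v') = a *: pure u v + pure u v'.
Proof. by rewrite /pure linearP /= mulmxDr scalemxAr. Qed.

Lemma tens_ext (W : vectType k) (F G : tens U V -> W) :
  linear F -> linear G -> (forall u v, F (pure u v) = G (pure u v)) -> F =1 G.
Proof.
move=> linF linG FG t.
pose FL : {linear tens U V -> W} := HB.pack F (GRing.isLinear.Build _ _ _ _ F linF).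
pose GL : {linear tens U V -> W} := HB.pack G (GRing.isLinear.Build _ _ _ _ G linG).
rewrite -[F]/(FL : _ -> _) -[G]/(GL : _ -> _) [t]matrix_sum_delta !linear_sum.
apply: eq_bigr => i _; rewrite !linear_sum; apply: eq_bigr => j _.
rewrite !linearZ /=; congr (_ *: _).
have -> : delta_mx i j = pure (r2v (delta_mx 0 i)) (r2v (delta_mx 0 j)).
  by rewrite /pure !r2vK trmx_delta mul_delta_mx.
exact: FG.
Qed.

Lemma tlift_linear (W : vectType k) (b : U -> V -> W) : linear (tlift b).
Proof.
move=> a t t'; rewrite /tlift scaler_sumr -big_split; apply: eq_bigr => i _ /=.
rewrite scaler_sumr -big_split; apply: eq_bigr => j _ /=.
by rewrite !mxE scalerDl scalerA.
Qed.

Lemma tlift_lin (W : vectType k) (b b1 b2 : U -> V -> W) a t :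
  (forall u v, b u v = a *: b1 u v + b2 u v) ->
  tlift b t = a *: tlift b1 t + tlift b2 t.
Proof.
move=> E; rewrite /tlift scaler_sumr -big_split; apply: eq_bigr => i _ /=.
rewrite scaler_sumr -big_split; apply: eq_bigr => j _ /=.
by rewrite E scalerDr !scalerA mulrC.
Qed.

Lemma tlift_pure (W : vectType k) (b : U -> V -> W) u v :
  (forall v, linear (b^~ v)) -> (forall u, linear (b u)) ->
  tlift b (pure u v) = b u v.
Proof.
move=> bl br.
pose BL v : {linear U -> W} := HB.pack (b^~ v) (GRing.isLinear.Build _ _ _ _ (b^~ v) (bl v)).
pose BR u : {linear V -> W} := HB.pack (b u) (GRing.isLinear.Build _ _ _ _ (b u) (br u)).
have -> : b u v = \sum_i \sum_j
    (v2r u 0 i * v2r v 0 j) *: b (r2v (delta_mx 0 i)) (r2v (delta_mx 0 j)).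
  rewrite -[LHS]/(BL v u) -[u in LHS]v2rK [v2r u in LHS]row_sum_delta !linear_sum.
  apply: eq_bigr => i _ /=; rewrite -[LHS]/(BL v _) !linearZ /=.
  rewrite -[b _ _]/(BR _ v) -[v in LHS]v2rK [v2r v in LHS]row_sum_delta !linear_sum.
  apply: eq_bigr => j _; rewrite linearZ /= -scalerA; congr (_ *: _).
  by rewrite -[LHS]/(BR _ _) linearZ.
rewrite /tlift; apply: eq_bigr => i _; apply: eq_bigr => j _.
by rewrite /pure mxE big_ord1 mxE.
Qed.
End Tens.

Declare Scope cat_scope.
Delimit Scope cat_scope with cat.
Local Open Scope cat_scope.

(* vectType makes the hom-spaces finite-dimensional over k. *)
Record category (k : fieldType) := Category {
  ob :> Type;
  mor : ob -> ob -> vectType k;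
  mid : forall X, mor X X;
  mcomp : forall X Y Z, mor Y Z -> mor X Y -> mor X Z;
  compA : forall W X Y Z (h : mor Y Z) (g : mor X Y) (f : mor W X),
    mcomp (mcomp h g) f = mcomp h (mcomp g f);
  comp1f : forall X Y (f : mor X Y), mcomp (mid Y) f = f;
  compf1 : forall X Y (f : mor X Y), mcomp f (mid X) = f;
  comp_linl : forall X Y Z (f : mor X Y), linear (fun g : mor Y Z => mcomp g f);
  comp_linr : forall X Y Z (g : mor Y Z), linear (fun f : mor X Y => mcomp g f)
}.
Arguments mor {k c} X Y.
Arguments mid {k c} X.
Arguments mcomp {k c X Y Z} g f.
Notation "g ∘ f" := (mcomp g f) (at level 37, right associativity) : cat_scope.

Record iso (k : fieldType) (C : category k) (X Y : C) := Iso {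
  fwd :> mor X Y;
  bwd : mor Y X;
  fwdK : bwd ∘ fwd = mid X;
  bwdK : fwd ∘ bwd = mid Y
}.
Notation "f ⁻¹" := (bwd f) (at level 2, left associativity, format "f ⁻¹") : cat_scope.

Record functor (k : fieldType) (C D : category k) := Functor {
  fob :> C -> D;
  fmap : forall X Y, mor X Y -> mor (fob X) (fob Y);
  fmap_id : forall X, fmap (mid X) = mid (fob X);
  fmap_comp : forall X Y Z (g : mor Y Z) (f : mor X Y),
    fmap (g ∘ f) = fmap g ∘ fmap f;
  fmap_lin : forall X Y, linear (@fmap X Y)
}.
Arguments fmap {k C D} _ {X Y} _.

Definition is_equivalence (k : fieldType) (C D : category k) (F : functor C D) :=
  exists (G : functor D C)
         (eta : forall X, iso (G (F X)) X) (eps : forall Y, iso (F (G Y)) Y),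
    (forall X X' (f : mor X X'), eta X' ∘ fmap G (fmap F f) = f ∘ eta X) /\
    (forall Y Y' (g : mor Y Y'), eps Y' ∘ fmap F (fmap G g) = g ∘ eps Y).

Section CategoryTheory.
Variables (k : fieldType) (C : category k).
Implicit Types X Y Z W : C.

Lemma compAl X Y Z W (h : mor Y Z) (g : mor X Y) (p : mor X Z) :
  h ∘ g = p -> forall f : mor W X, h ∘ (g ∘ f) = p ∘ f.
Proof. by move=> <- f; rewrite compA. Qed.

Lemma iso_epi X Y (i : iso X Y) Z (f g : mor Y Z) : f ∘ i = g ∘ i -> f = g.
Proof.
by move=> /(congr1 (fun h => h ∘ i⁻¹)); rewrite !compA bwdK !compf1.
Qed.
Lemma iso_mono X Y (i : iso X Y) Z (f g : mor Z X) : i ∘ f = i ∘ g -> f = g.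
Proof.
by move=> /(congr1 (fun h => i⁻¹ ∘ h)); rewrite -!compA fwdK !comp1f.
Qed.

Definition iso_sym X Y (i : iso X Y) : iso Y X := Iso (bwdK i) (fwdK i).

Fact iso_comp_fwdK X Y Z (j : iso Y Z) (i : iso X Y) :
  (i⁻¹ ∘ j⁻¹) ∘ (j ∘ i) = mid X.
Proof. by rewrite compA -(compA j⁻¹) fwdK comp1f fwdK. Qed.
Fact iso_comp_bwdK X Y Z (j : iso Y Z) (i : iso X Y) :
  (j ∘ i) ∘ (i⁻¹ ∘ j⁻¹) = mid Z.
Proof. by rewrite compA -(compA i) bwdK comp1f bwdK. Qed.
Definition iso_comp X Y Z (j : iso Y Z) (i : iso X Y) : iso X Z :=
  Iso (iso_comp_fwdK j i) (iso_comp_bwdK j i).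
Definition iso_id X : iso X X := Iso (comp1f (mid X)) (comp1f (mid X)).

Definition is_iso X Y (f : mor X Y) := exists g, g ∘ f = mid X /\ f ∘ g = mid Y.
Definition is_mono X Y (f : mor X Y) :=
  forall W (g h : mor W X), f ∘ g = f ∘ h -> g = h.
Definition is_epi X Y (f : mor X Y) :=
  forall W (g h : mor Y W), g ∘ f = h ∘ f -> g = h.
Definition is_zero X := mid X = 0.

Definition is_kernel X Y (f : mor X Y) K (i : mor K X) :=
  f ∘ i = 0 /\
  forall W (g : mor W X), f ∘ g = 0 -> exists! h : mor W K, i ∘ h = g.
Definition is_cokernel X Y (f : mor X Y) Q (p : mor Y Q) :=
  p ∘ f = 0 /\
  forall W (g : mor Y W), g ∘ f = 0 -> exists! h : mor Q W, h ∘ p = g.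

Definition is_direct_sum n (S : 'I_n -> C) X :=
  exists (inj : forall i, mor (S i) X) (pr : forall i, mor X (S i)),
    [/\ forall i, pr i ∘ inj i = mid (S i),
        forall i j, i != j -> pr j ∘ inj i = 0
      & \sum_i inj i ∘ pr i = mid X].

(* The case n = 0 of the first clause provides a zero object. *)
Definition is_abelian :=
  [/\ forall n (S : 'I_n -> C), exists X, is_direct_sum S X,
      forall X Y (f : mor X Y), exists K (i : mor K X), is_kernel f i,
      forall X Y (f : mor X Y), exists Q (p : mor Y Q), is_cokernel f p,
      forall X Y (f : mor X Y), is_mono f -> exists Z (g : mor Y Z), is_kernel g f
    & forall X Y (f : mor X Y), is_epi f -> exists Z (g : mor Z X), is_cokernel g f].

Definition is_simple X :=
  ~ is_zero X /\
  forall Z (f : mor Z X), is_mono f -> is_zero Z \/ is_iso f.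

(* The field k need not be algebraically closed, so that the last clause is not
   automatic; it is what makes the coend of Y^∨ ⊠ Y the direct sum over the
   isomorphism classes of simple objects. *)
Definition is_semisimple :=
  [/\ is_abelian,
      forall X, exists n (S : 'I_n -> C),
        (forall i, is_simple (S i)) /\ is_direct_sum S X
    & forall S, is_simple S -> forall f : mor S S, exists a : k, f = a *: mid S].

End CategoryTheory.

Section Deligne.
Variables (k : fieldType) (C D : category k).

(* The formal finite direct sum of the objects dl i ⊠ dr i, i < dn.  Morphisms
   are matrices with entries in the tensor products of the hom-spaces.  For
   semisimple categories in which the endomorphisms of simple objects are
   scalars, this category is abelian, every bilinear functor is exact in each
   variable, and dbox below is universal among bilinear functors to abelian
   categories, so that this is the Deligne tensor product. *)
Record dob := DOb { dn : nat; dl : 'I_dn -> C; dr : 'I_dn -> D }.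

Definition tcomp X Y Z X' Y' Z'
    (s : tens (@mor _ C Y Z) (@mor _ D Y' Z')) (t : tens (@mor _ C X Y) (@mor _ D X' Y')) :
  tens (@mor _ C X Z) (@mor _ D X' Z') :=
  tlift (fun g g' => tlift (fun f f' => pure (g ∘ f) (g' ∘ f')) t) s.

Lemma tcomp_linl X Y Z X' Y' Z' t : linear (fun s => @tcomp X Y Z X' Y' Z' s t).
Proof. by move=> a s s'; rewrite /tcomp tlift_linear. Qed.

Lemma tcomp_linr X Y Z X' Y' Z' s : linear (@tcomp X Y Z X' Y' Z' s).
Proof.
by move=> a t t'; apply: tlift_lin => u v; rewrite tlift_linear.
Qed.

Lemma tcomp_pure X Y Z X' Y' Z' (g : @mor _ C Y Z) (g' : @mor _ D Y' Z')
    (f : @mor _ C X Y) (f' : @mor _ D X' Y') :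
  tcomp (pure g g') (pure f f') = pure (g ∘ f) (g' ∘ f').
Proof.
have E u v : tlift (fun f f' => pure (u ∘ f) (v ∘ f')) (pure f f') = pure (u ∘ f) (v ∘ f').
  by rewrite tlift_pure // => w a x y; rewrite comp_linr ?pure_linl ?pure_linr.
rewrite /tcomp tlift_pure ?E // => w a x y; rewrite !E comp_linl.
  by rewrite pure_linl.
by rewrite pure_linr.
Qed.

Lemma tcompA X Y Z W X' Y' Z' W' (u : tens (@mor _ C Z W) (@mor _ D Z' W'))
    (s : tens (@mor _ C Y Z) (@mor _ D Y' Z')) (t : tens (@mor _ C X Y) (@mor _ D X' Y')) :
  tcomp (tcomp u s) t = tcomp u (tcomp s t).
Proof.
move: u; apply: tens_ext => [a u u'|a u u'|h h'].
- by rewrite !tcomp_linl.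
- by rewrite !tcomp_linl.
move: s; apply: tens_ext => [a u u'|a u u'|g g'].
- by rewrite tcomp_linr !tcomp_linl.
- by rewrite tcomp_linl !tcomp_linr.
move: t; apply: tens_ext => [a u u'|a u u'|f f'].
- by rewrite !tcomp_linr.
- by rewrite !tcomp_linr.
by rewrite !tcomp_pure !compA.
Qed.

Definition tid X X' : tens (@mor _ C X X) (@mor _ D X' X') := pure (mid X) (mid X').

Lemma tcomp1t X Y X' Y' (t : tens (@mor _ C X Y) (@mor _ D X' Y')) :
  tcomp (tid Y Y') t = t.
Proof.
move: t; apply: tens_ext => [a u u'|//|f f'].
  by rewrite tcomp_linr.
by rewrite tcomp_pure !comp1f.
Qed.
Lemma tcompt1 X Y X' Y' (t : tens (@mor _ C X Y) (@mor _ D X' Y')) :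
  tcomp t (tid X X') = t.
Proof.
move: t; apply: tens_ext => [a u u'|//|f f'].
  by rewrite tcomp_linl.
by rewrite tcomp_pure !compf1.
Qed.

Definition dentry (S T : dob) (i : 'I_(dn S)) (j : 'I_(dn T)) : vectType k :=
  tens (mor (dl i) (dl j)) (mor (dr i) (dr j)).
Definition dhom (S T : dob) : vectType k :=
  famv (fun i : 'I_(dn S) => famv (fun j : 'I_(dn T) => dentry i j)).

Definition mkfam n (V : 'I_n -> vectType k) (f : forall i, V i) : famv V := finfun f.
Definition mkdhom S T (f : forall i j, @dentry S T i j) : dhom S T :=
  mkfam (fun i => mkfam (f i)).
Lemma mkdhomE S T f i j : @mkdhom S T f i j = f i j.
Proof. by rewrite /mkdhom /mkfam !ffunE. Qed.
Lemma dhomP S T (f g : dhom S T) : (forall i j, f i j = g i j) -> f = g.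
Proof. by move=> E; apply/ffunP=> i; apply/ffunP=> j; apply: E. Qed.
Lemma dhom_linE S T a (f g : dhom S T) i j :
  (a *: f + g) i j = a *: f i j + g i j.
Proof. by rewrite !fam_linE. Qed.

Definition did_entry S (i j : 'I_(dn S)) : @dentry S S i j :=
  match i =P j with
  | ReflectT e => match e in _ = j return @dentry S S i j with
                  | erefl => tid (dl i) (dr i)
                  end
  | ReflectF _ => 0
  end.
Definition did S : dhom S S := mkdhom (@did_entry S).
Definition dcomp S T U (g : dhom T U) (f : dhom S T) : dhom S U :=
  mkdhom (fun i l => \sum_j tcomp (g j l) (f i j)).

Lemma did_entryii S i : @did_entry S i i = tid (dl i) (dr i).
Proof. by rewrite /did_entry; case: eqP => // e; rewrite (eq_axiomK e). Qed.
Lemma did_entryij S i j : i != j -> @did_entry S i j = 0.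
Proof. by rewrite /did_entry; case: eqP. Qed.

Lemma tcomp0t X Y Z X' Y' Z' t : @tcomp X Y Z X' Y' Z' 0 t = 0.
Proof. exact: (linear_pred0 (tcomp_linl t)). Qed.
Lemma tcompt0 X Y Z X' Y' Z' s : @tcomp X Y Z X' Y' Z' s 0 = 0.
Proof. exact: (linear_pred0 (tcomp_linr s)). Qed.
Lemma tcomp_suml J (r : seq J) X Y Z X' Y' Z' F t :
  @tcomp X Y Z X' Y' Z' (\sum_(j <- r) F j) t = \sum_(j <- r) tcomp (F j) t.
Proof.
elim: r => [|j r IH]; first by rewrite !big_nil tcomp0t.
by rewrite !big_cons -IH (linear_predD _ _ (tcomp_linl _)).
Qed.
Lemma tcomp_sumr J (r : seq J) X Y Z X' Y' Z' F s :
  @tcomp X Y Z X' Y' Z' s (\sum_(j <- r) F j) = \sum_(j <- r) tcomp s (F j).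
Proof.
elim: r => [|j r IH]; first by rewrite !big_nil tcompt0.
by rewrite !big_cons -IH (linear_predD _ _ (tcomp_linr _)).
Qed.

Fact dcompA S T U V (h : dhom U V) (g : dhom T U) (f : dhom S T) :
  dcomp (dcomp h g) f = dcomp h (dcomp g f).
Proof.
apply: dhomP => i m; rewrite !mkdhomE.
under eq_bigr do rewrite mkdhomE tcomp_suml.
under [RHS]eq_bigr do rewrite mkdhomE tcomp_sumr.
rewrite exchange_big; apply: eq_bigr => l _; apply: eq_bigr => j _.
exact: tcompA.
Qed.
Fact dcomp1f S T (f : dhom S T) : dcomp (did T) f = f.
Proof.
apply: dhomP => i l; rewrite mkdhomE (bigD1 l) //= mkdhomE did_entryii tcomp1t.
by rewrite big1 ?addr0 // => j jl; rewrite mkdhomE did_entryij // tcomp0t.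
Qed.
Fact dcompf1 S T (f : dhom S T) : dcomp f (did S) = f.
Proof.
apply: dhomP => i l; rewrite mkdhomE (bigD1 i) //= mkdhomE did_entryii tcompt1.
by rewrite big1 ?addr0 // => j ji; rewrite mkdhomE did_entryij 1?eq_sym // tcompt0.
Qed.
Fact dcomp_linl S T U (f : dhom S T) : linear (fun g : dhom T U => dcomp g f).
Proof.
move=> a g g'; apply: dhomP => i l; rewrite dhom_linE !mkdhomE scaler_sumr -big_split.
by apply: eq_bigr => j _; rewrite dhom_linE tcomp_linl.
Qed.
Fact dcomp_linr S T U (g : dhom T U) : linear (fun f : dhom S T => dcomp g f).
Proof.
move=> a f f'; apply: dhomP => i l; rewrite dhom_linE !mkdhomE scaler_sumr -big_split.
by apply: eq_bigr => j _; rewrite dhom_linE tcomp_linr.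
Qed.

Definition deligne : category k :=
  Category dcompA dcomp1f dcompf1 dcomp_linl dcomp_linr.

Definition dbox (X : C) (Y : D) : deligne := DOb (fun _ : 'I_1 => X) (fun=> Y).
Definition dboxm X X' Y Y' (f : @mor _ C X X') (g : @mor _ D Y Y') :
  @mor _ deligne (dbox X Y) (dbox X' Y') := @mkdhom (dbox X Y) (dbox X' Y') (fun _ _ => pure f g).

End Deligne.

Reserved Notation "X ⊗ Y" (at level 35, right associativity).
Reserved Notation "f ⊗₁ g" (at level 35, right associativity).
Reserved Notation "X ◁ f" (at level 34, right associativity).
Reserved Notation "f ▷ X" (at level 33, left associativity).

(* Monoidal categories are not assumed strict: the associativity and unit
   constraints, suppressed on paper, are written out. *)
Record monoidal (k : fieldType) := Monoidal {
  mcat :> category k;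
  tob : mcat -> mcat -> mcat;
  tmor : forall X X' Y Y' : mcat,
    mor X X' -> mor Y Y' -> mor (tob X Y) (tob X' Y');
  tunit : mcat;
  assoc : forall X Y Z : mcat, iso (tob (tob X Y) Z) (tob X (tob Y Z));
  lunit : forall X : mcat, iso (tob tunit X) X;
  runit : forall X : mcat, iso (tob X tunit) X;
  tmor_id : forall X Y : mcat, tmor (mid X) (mid Y) = mid (tob X Y);
  tmor_comp : forall (X X' X'' Y Y' Y'' : mcat) (f' : mor X' X'') (f : mor X X')
      (g' : mor Y' Y'') (g : mor Y Y'),
    tmor (f' ∘ f) (g' ∘ g) = tmor f' g' ∘ tmor f g;
  tmor_linl : forall (X X' Y Y' : mcat) (g : mor Y Y'),
    linear (fun f : mor X X' => tmor f g);
  tmor_linr : forall (X X' Y Y' : mcat) (f : mor X X'),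
    linear (fun g : mor Y Y' => tmor f g);
  assoc_nat : forall (X X' Y Y' Z Z' : mcat)
      (f : mor X X') (g : mor Y Y') (h : mor Z Z'),
    assoc X' Y' Z' ∘ tmor (tmor f g) h = tmor f (tmor g h) ∘ assoc X Y Z;
  lunit_nat : forall (X X' : mcat) (f : mor X X'),
    lunit X' ∘ tmor (mid tunit) f = f ∘ lunit X;
  runit_nat : forall (X X' : mcat) (f : mor X X'),
    runit X' ∘ tmor f (mid tunit) = f ∘ runit X;
  pentagon : forall W X Y Z : mcat,
    assoc W X (tob Y Z) ∘ assoc (tob W X) Y Z =
    tmor (mid W) (assoc X Y Z) ∘ assoc W (tob X Y) Z ∘ tmor (assoc W X Y) (mid Z);
  triangle : forall X Y : mcat,
    tmor (mid X) (lunit Y) ∘ assoc X tunit Y = tmor (runit X) (mid Y)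
}.
Arguments tmor {k m X X' Y Y'} f g.
Arguments tunit {k m}.
Arguments assoc {k m} X Y Z.
Arguments lunit {k m} X.
Arguments runit {k m} X.
Notation "X ⊗ Y" := (tob X Y) : cat_scope.
Notation "f ⊗₁ g" := (tmor f g) : cat_scope.
Notation "X ◁ f" := (tmor (mid X) f) : cat_scope.
Notation "f ▷ X" := (tmor f (mid X)) : cat_scope.
Notation "𝟙" := tunit : cat_scope.
Notation α := assoc.
Notation λ := lunit.
Notation ρ := runit.

Section MonoidalTheory.
Variables (k : fieldType) (C : monoidal k).
Implicit Types X Y Z W : C.

Lemma wl_comp X Y Y' Y'' (g : mor Y' Y'') (f : mor Y Y') :
  X ◁ (g ∘ f) = (X ◁ g) ∘ (X ◁ f).
Proof. by rewrite -tmor_comp comp1f. Qed.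
Lemma wr_comp X Y Y' Y'' (g : mor Y' Y'') (f : mor Y Y') :
  (g ∘ f) ▷ X = (g ▷ X) ∘ (f ▷ X).
Proof. by rewrite -tmor_comp comp1f. Qed.
Lemma tmorE X X' Y Y' (f : mor X X') (g : mor Y Y') : f ⊗₁ g = (f ▷ Y') ∘ (X ◁ g).
Proof. by rewrite -tmor_comp comp1f compf1. Qed.
Lemma tmorE' X X' Y Y' (f : mor X X') (g : mor Y Y') : f ⊗₁ g = (X' ◁ g) ∘ (f ▷ Y).
Proof. by rewrite -tmor_comp comp1f compf1. Qed.
Lemma tmor_interchange X X' Y Y' (f : mor X X') (g : mor Y Y') :
  (f ▷ Y') ∘ (X ◁ g) = (X' ◁ g) ∘ (f ▷ Y).
Proof. by rewrite -tmorE tmorE'. Qed.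

Lemma assoc_natl X X' Y Z (f : mor X X') :
  α X' Y Z ∘ ((f ▷ Y) ▷ Z) = (f ▷ (Y ⊗ Z)) ∘ α X Y Z.
Proof. by rewrite assoc_nat tmor_id. Qed.
Lemma assoc_natm X Y Y' Z (g : mor Y Y') :
  α X Y' Z ∘ ((X ◁ g) ▷ Z) = (X ◁ (g ▷ Z)) ∘ α X Y Z.
Proof. by rewrite assoc_nat. Qed.
Lemma assoc_natr X Y Z Z' (h : mor Z Z') :
  α X Y Z' ∘ ((X ⊗ Y) ◁ h) = (X ◁ (Y ◁ h)) ∘ α X Y Z.
Proof. by rewrite -assoc_nat tmor_id. Qed.

Lemma iso_conj X Y X' Y' (i : iso X X') (j : iso Y Y') (f : mor X Y) (g : mor X' Y') :
  j ∘ f = g ∘ i -> f ∘ i⁻¹ = j⁻¹ ∘ g.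
Proof.
move=> E; apply: (iso_epi (i := i)); apply: (iso_mono (i := j)).
by rewrite !compA fwdK compf1 E -[RHS]compA bwdK comp1f.
Qed.

Lemma associ_natl X X' Y Z (f : mor X X') :
  ((f ▷ Y) ▷ Z) ∘ (α X Y Z)⁻¹ = (α X' Y Z)⁻¹ ∘ (f ▷ (Y ⊗ Z)).
Proof. exact/iso_conj/assoc_natl. Qed.
Lemma associ_natm X Y Y' Z (g : mor Y Y') :
  ((X ◁ g) ▷ Z) ∘ (α X Y Z)⁻¹ = (α X Y' Z)⁻¹ ∘ (X ◁ (g ▷ Z)).
Proof. exact/iso_conj/assoc_natm. Qed.
Lemma associ_natr X Y Z Z' (h : mor Z Z') :
  ((X ⊗ Y) ◁ h) ∘ (α X Y Z)⁻¹ = (α X Y Z')⁻¹ ∘ (X ◁ (Y ◁ h)).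
Proof. exact/iso_conj/assoc_natr. Qed.

Lemma wlK X Y Z (i : iso Y Z) : (X ◁ i⁻¹) ∘ (X ◁ i) = mid _.
Proof. by rewrite -wl_comp fwdK tmor_id. Qed.
Lemma wlKV X Y Z (i : iso Y Z) : (X ◁ i) ∘ (X ◁ i⁻¹) = mid _.
Proof. by rewrite -wl_comp bwdK tmor_id. Qed.
Lemma wrK X Y Z (i : iso Y Z) : (i⁻¹ ▷ X) ∘ (i ▷ X) = mid _.
Proof. by rewrite -wr_comp fwdK tmor_id. Qed.
Lemma wrKV X Y Z (i : iso Y Z) : (i ▷ X) ∘ (i⁻¹ ▷ X) = mid _.
Proof. by rewrite -wr_comp bwdK tmor_id. Qed.
Definition wl_iso X Y Z (i : iso Y Z) : iso (X ⊗ Y) (X ⊗ Z) := Iso (wlK X i) (wlKV X i).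
Definition wr_iso X Y Z (i : iso Y Z) : iso (Y ⊗ X) (Z ⊗ X) := Iso (wrK X i) (wrKV X i).

Lemma pentagonV W X Y Z :
  (α (W ⊗ X) Y Z)⁻¹ ∘ (α W X (Y ⊗ Z))⁻¹ =
  ((α W X Y)⁻¹ ▷ Z) ∘ (α W (X ⊗ Y) Z)⁻¹ ∘ (W ◁ (α X Y Z)⁻¹).
Proof.
pose i := iso_comp (α W X (Y ⊗ Z)) (α (W ⊗ X) Y Z).
pose j := iso_comp (wl_iso W (α X Y Z)) (iso_comp (α W (X ⊗ Y) Z) (wr_iso Z (α W X Y))).
have ij : fwd i = fwd j by rewrite /= pentagon.
suff : i⁻¹ = j⁻¹ by rewrite /= !compA.
by apply: (iso_epi (i := i)); rewrite fwdK ij fwdK.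
Qed.

Lemma pentagon3 W X Y Z :
  α W (X ⊗ Y) Z ∘ (α W X Y ▷ Z) ∘ (α (W ⊗ X) Y Z)⁻¹ =
  (W ◁ (α X Y Z)⁻¹) ∘ α W X (Y ⊗ Z).
Proof.
apply: (iso_mono (i := wl_iso W (α X Y Z))) => /=.
rewrite -[RHS]compA wlKV comp1f.
apply: (iso_epi (i := α (W ⊗ X) Y Z)).
by rewrite !compA fwdK compf1 pentagon.
Qed.

Lemma pentagon4 W X Y Z :
  (α W X (Y ⊗ Z))⁻¹ ∘ (W ◁ α X Y Z) ∘ α W (X ⊗ Y) Z =
  α (W ⊗ X) Y Z ∘ ((α W X Y)⁻¹ ▷ Z).
Proof.
apply: (iso_mono (i := α W X (Y ⊗ Z))).
rewrite -[LHS]compA bwdK comp1f.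
apply: (iso_epi (i := wr_iso Z (α W X Y))) => /=.
by rewrite !compA wrK compf1 pentagon.
Qed.

Lemma lunit_inj X Y (f g : mor X Y) : 𝟙 ◁ f = 𝟙 ◁ g -> f = g.
Proof.
move=> E; apply: (iso_epi (i := λ X)).
by rewrite -!lunit_nat E.
Qed.
Lemma runit_inj X Y (f g : mor X Y) : f ▷ 𝟙 = g ▷ 𝟙 -> f = g.
Proof.
move=> E; apply: (iso_epi (i := ρ X)).
by rewrite -!runit_nat E.
Qed.

Lemma lunit_tens X Y : λ (X ⊗ Y) ∘ α 𝟙 X Y = λ X ▷ Y.
Proof.
apply: lunit_inj.
apply: (iso_epi (i := α 𝟙 (𝟙 ⊗ X) Y)).
apply: (iso_epi (i := wr_iso Y (α 𝟙 𝟙 X))) => /=.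
rewrite wl_comp !compA -pentagon -[LHS]compA triangle -(tmor_id X Y).
by rewrite -assoc_nat -[RHS]compA -assoc_natm !compA -wr_comp triangle.
Qed.

Lemma runit_tens X Y : (X ◁ ρ Y) ∘ α X Y 𝟙 = ρ (X ⊗ Y).
Proof.
apply: runit_inj.
apply: (iso_mono (i := α X Y 𝟙)).
rewrite wr_comp -[LHS]compA assoc_natm !compA -triangle wl_comp !compA.
by rewrite -pentagon -[LHS]compA -assoc_natr compA triangle.
Qed.

Lemma lunit_unit : λ 𝟙 = ρ 𝟙 :> mor (𝟙 ⊗ 𝟙) (𝟙 : C).
Proof.
apply: runit_inj; rewrite -lunit_tens -triangle.
congr (_ ∘ _); apply: (iso_mono (i := λ 𝟙)).
by rewrite lunit_nat.
Qed.
End MonoidalTheory.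

Record algebra (k : fieldType) (C : monoidal k) := Algebra {
  alg_ob :> C;
  alg_mul : mor (alg_ob ⊗ alg_ob) alg_ob;
  alg_unit : mor 𝟙 alg_ob;
  alg_mulA : alg_mul ∘ (alg_mul ▷ alg_ob) =
             alg_mul ∘ (alg_ob ◁ alg_mul) ∘ α alg_ob alg_ob alg_ob;
  alg_mul1l : alg_mul ∘ (alg_unit ▷ alg_ob) = λ alg_ob;
  alg_mul1r : alg_mul ∘ (alg_ob ◁ alg_unit) = ρ alg_ob
}.

Definition is_alg_hom (k : fieldType) (C : monoidal k) (A B : algebra C) (f : mor A B) :=
  f ∘ alg_mul A = alg_mul B ∘ (f ⊗₁ f) /\ f ∘ alg_unit A = alg_unit B.

Record braided (k : fieldType) := Braided {
  bmon :> monoidal k;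
  braid : forall X Y : bmon, iso (X ⊗ Y) (Y ⊗ X);
  braid_nat : forall (X X' Y Y' : bmon) (f : mor X X') (g : mor Y Y'),
    braid X' Y' ∘ (f ⊗₁ g) = (g ⊗₁ f) ∘ braid X Y;
  hexagon1 : forall X Y Z : bmon,
    α Y Z X ∘ braid X (Y ⊗ Z) ∘ α X Y Z =
    (Y ◁ braid X Z) ∘ α Y X Z ∘ (braid X Y ▷ Z);
  hexagon2 : forall X Y Z : bmon,
    (α Z X Y)⁻¹ ∘ braid (X ⊗ Y) Z ∘ (α X Y Z)⁻¹ =
    (braid X Z ▷ Y) ∘ (α X Z Y)⁻¹ ∘ (X ◁ braid Y Z)
}.
Arguments braid {k b} X Y.

Section LeftCentre.
Variables (k : fieldType) (D : braided k) (B : algebra D).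

Definition left_central (Y : D) (y : mor Y B) :=
  alg_mul B ∘ (y ▷ B) = alg_mul B ∘ (B ◁ y) ∘ braid Y B.

(* The left centre: a terminal left central morphism y, with an algebra
   structure on its source for which y is a homomorphism. *)
Definition is_left_centre (L : algebra D) (y : mor L B) :=
  [/\ left_central y,
      forall (Y : D) (y' : mor Y B), left_central y' ->
        exists! f : mor Y L, y ∘ f = y'
    & is_alg_hom y].
End LeftCentre.

Section Centre.
Variables (k : fieldType) (C : monoidal k).

Record half_braiding (Z : C) := HalfBraiding {
  hb :> forall X : C, iso (Z ⊗ X) (X ⊗ Z);
  hb_nat : forall (X Y : C) (f : mor X Y), hb Y ∘ (Z ◁ f) = (f ▷ Z) ∘ hb X;
  hb_unit : λ Z ∘ hb 𝟙 = ρ Z;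
  hb_tens : forall X Y : C,
    α X Y Z ∘ hb (X ⊗ Y) ∘ α Z X Y = (X ◁ hb Y) ∘ α X Z Y ∘ (hb X ▷ Y)
}.

Record zob := ZOb { zcar : C; zhb : half_braiding zcar }.

Definition hb_compat (Z W : zob) (f : mor (zcar Z) (zcar W)) :=
  forall X, zhb W X ∘ (f ▷ X) = (X ◁ f) ∘ zhb Z X.

Fact hb_compat0 Z W : @hb_compat Z W 0.
Proof.
move=> X; rewrite (linear_pred0 (tmor_linl _)) (linear_pred0 (tmor_linr _)).
by rewrite (linear_pred0 (comp_linl _)) (linear_pred0 (comp_linr _)).
Qed.
Fact hb_compatL Z W a (f g : mor (zcar Z) (zcar W)) :
  hb_compat f -> hb_compat g -> hb_compat (a *: f + g).
Proof.
by move=> cf cg X; rewrite tmor_linl tmor_linr comp_linl comp_linr cf cg.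
Qed.

Definition zhom (Z W : zob) : vectType k :=
  subvs_of (vspace_of_pred (hb_compat0 Z W) (@hb_compatL Z W)).
Definition zval (Z W : zob) (f : zhom Z W) : mor (zcar Z) (zcar W) := vsval f.
Definition zmk (Z W : zob) (f : mor (zcar Z) (zcar W)) (cf : hb_compat f) : zhom Z W :=
  Subvs (iffRL (vspace_of_predP _ _ _) cf).

Lemma zvalP Z W (f : zhom Z W) : hb_compat (zval f).
Proof.
exact: (iffLR (vspace_of_predP (hb_compat0 Z W) (@hb_compatL Z W) _) (subvsP f)).
Qed.
Lemma zval_inj Z W (f g : zhom Z W) : zval f = zval g -> f = g.
Proof. exact: subvs_inj. Qed.
Lemma zvalK Z W (f : mor (zcar Z) (zcar W)) (cf : hb_compat f) : zval (zmk cf) = f.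
Proof. by []. Qed.
Lemma zval_lin Z W : linear (@zval Z W).
Proof. exact: linearP. Qed.

Fact zid_compat Z : @hb_compat Z Z (mid _).
Proof. by move=> X; rewrite !tmor_id compf1 comp1f. Qed.
Fact zcomp_compat X Y Z (g : zhom Y Z) (f : zhom X Y) :
  @hb_compat X Z (zval g ∘ zval f).
Proof.
by move=> V; rewrite wr_comp wl_comp -compA zvalP compA zvalP -compA.
Qed.
Definition zid Z : zhom Z Z := zmk (zid_compat Z).
Definition zcomp X Y Z (g : zhom Y Z) (f : zhom X Y) : zhom X Z :=
  zmk (zcomp_compat g f).
Fact zcompA W X Y Z (h : zhom Y Z) (g : zhom X Y) (f : zhom W X) :
  zcomp (zcomp h g) f = zcomp h (zcomp g f).
Proof. by apply: zval_inj; rewrite /= compA. Qed.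
Fact zcomp1f X Y (f : zhom X Y) : zcomp (zid Y) f = f.
Proof. by apply: zval_inj; rewrite /= comp1f. Qed.
Fact zcompf1 X Y (f : zhom X Y) : zcomp f (zid X) = f.
Proof. by apply: zval_inj; rewrite /= compf1. Qed.
Fact zcomp_linl X Y Z (f : zhom X Y) : linear (fun g : zhom Y Z => zcomp g f).
Proof. by move=> a g g'; apply: zval_inj; rewrite zval_lin /= -comp_linl -zval_lin. Qed.
Fact zcomp_linr X Y Z (g : zhom Y Z) : linear (fun f : zhom X Y => zcomp g f).
Proof. by move=> a g' f; apply: zval_inj; rewrite zval_lin /= -comp_linr -zval_lin. Qed.

Definition centre_cat : category k :=
  Category zcompA zcomp1f zcompf1 zcomp_linl zcomp_linr.

Lemma hb_compatV (Z W : zob) (i : iso (zcar Z) (zcar W)) :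
  @hb_compat Z W i -> @hb_compat W Z i⁻¹.
Proof.
move=> ci X; apply: (iso_epi (i := wr_iso X i)); apply: (iso_mono (i := wl_iso X i)) => /=.
by rewrite ?compA wrK compf1 ci -[RHS]compA wlKV comp1f.
Qed.
Definition ziso (Z W : zob) (i : iso (zcar Z) (zcar W)) (ci : @hb_compat Z W i) :
  @iso k centre_cat Z W.
Proof.
by exists (zmk ci) (zmk (hb_compatV ci)); apply: zval_inj; rewrite /= ?fwdK ?bwdK.
Defined.

Section ZTens.
Variables (Z W : zob).
Let z := zhb Z.
Let w := zhb W.
Definition tens_hb (X : C) : iso ((zcar Z ⊗ zcar W) ⊗ X) (X ⊗ (zcar Z ⊗ zcar W)) :=
  iso_comp (α X (zcar Z) (zcar W))
  (iso_comp (wr_iso (zcar W) (z X))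
  (iso_comp (iso_sym (α (zcar Z) X (zcar W)))
  (iso_comp (wl_iso (zcar Z) (w X)) (α (zcar Z) (zcar W) X)))).

Lemma tens_hbE X : tens_hb X =
  α X (zcar Z) (zcar W) ∘ (z X ▷ zcar W) ∘ (α (zcar Z) X (zcar W))⁻¹ ∘
  (zcar Z ◁ w X) ∘ α (zcar Z) (zcar W) X :> mor _ _.
Proof. by []. Qed.

Fact tens_hb_nat X Y (f : mor X Y) :
  tens_hb Y ∘ ((zcar Z ⊗ zcar W) ◁ f) = (f ▷ (zcar Z ⊗ zcar W)) ∘ tens_hb X.
Proof.
rewrite !tens_hbE ?compA assoc_natr.
rewrite (compAl (p := (zcar Z ◁ (f ▷ zcar W)) ∘ (zcar Z ◁ w X))); last first.
  by rewrite -!wl_comp hb_nat.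
rewrite compA (compAl (esym (associ_natm _ _ _))).
rewrite compA (compAl (p := ((f ▷ zcar Z) ▷ zcar W) ∘ (z X ▷ zcar W))); last first.
  by rewrite -!wr_comp hb_nat.
by rewrite compA (compAl (assoc_natl _ _ _)) compA.
Qed.

Fact tens_hb_unit : λ (zcar Z ⊗ zcar W) ∘ tens_hb 𝟙 = ρ (zcar Z ⊗ zcar W).
Proof.
rewrite tens_hbE (compAl (lunit_tens _ _)).
rewrite (compAl (p := ρ (zcar Z) ▷ zcar W)); last by rewrite -wr_comp hb_unit.
rewrite -triangle compA (compAl (bwdK _)) comp1f.
rewrite (compAl (p := zcar Z ◁ ρ (zcar W))); last by rewrite -wl_comp hb_unit.
by rewrite runit_tens.
Qed.

Fact tens_hb_tens X Y :
  α X Y (zcar Z ⊗ zcar W) ∘ tens_hb (X ⊗ Y) ∘ α (zcar Z ⊗ zcar W) X Y =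
  (X ◁ tens_hb Y) ∘ α X (zcar Z ⊗ zcar W) Y ∘ (tens_hb X ▷ Y).
Proof.
set P := zcar Z; set Q := zcar W.
have Ez : (α X Y P ▷ Q) ∘ (z (X ⊗ Y) ▷ Q) =
   ((X ◁ z Y) ▷ Q) ∘ (α X P Y ▷ Q) ∘ ((z X ▷ Y) ▷ Q) ∘ ((α P X Y)⁻¹ ▷ Q).
  rewrite -!wr_comp; congr (_ ▷ _).
  by apply: (iso_epi (i := α P X Y)); rewrite ?compA hb_tens fwdK compf1.
have Ew : (P ◁ w (X ⊗ Y)) ∘ (P ◁ α Q X Y) =
   (P ◁ (α X Y Q)⁻¹) ∘ (P ◁ (X ◁ w Y)) ∘ (P ◁ α X Q Y) ∘ (P ◁ (w X ▷ Y)).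
  rewrite -!wl_comp; congr (_ ◁ _).
  by apply: (iso_mono (i := α X Y Q)); rewrite hb_tens -[RHS]compA bwdK comp1f.
rewrite !tens_hbE -/P -/Q ?compA pentagon (compAl (pentagon _ _ _ _)) ?compA.
rewrite (compAl Ez) ?compA (compAl Ew) ?compA.
have Em : ((α P X Y)⁻¹ ▷ Q) ∘ (α P (X ⊗ Y) Q)⁻¹ ∘ (P ◁ (α X Y Q)⁻¹) =
   (α (P ⊗ X) Y Q)⁻¹ ∘ (α P X (Y ⊗ Q))⁻¹ by rewrite pentagonV.
have Em' V (f : mor V _) : ((α P X Y)⁻¹ ▷ Q) ∘ (α P (X ⊗ Y) Q)⁻¹ ∘ (P ◁ (α X Y Q)⁻¹) ∘ f =
   (α (P ⊗ X) Y Q)⁻¹ ∘ (α P X (Y ⊗ Q))⁻¹ ∘ f.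
  by have := congr1 (fun h => h ∘ f) Em; rewrite ?compA.
rewrite Em'.
rewrite (compAl (assoc_natm _ _ _)) ?compA.
rewrite (compAl (associ_natl _ _ _)) ?compA.
rewrite (compAl (esym (associ_natr _ _ _))) ?compA.
rewrite (compAl (tmor_interchange _ _)) ?compA.
have E3 V (f : mor V _) : α X (P ⊗ Y) Q ∘ (α X P Y ▷ Q) ∘ (α (X ⊗ P) Y Q)⁻¹ ∘ f =
   (X ◁ (α P Y Q)⁻¹) ∘ α X P (Y ⊗ Q) ∘ f.
  by have := congr1 (fun h => h ∘ f) (pentagon3 X P Y Q); rewrite ?compA.
rewrite E3 (compAl (assoc_natr _ _ _)) ?compA.
rewrite (compAl (esym (assoc_natm _ _ (w X)))) ?compA.
have E4 V (f : mor V _) : (α P X (Q ⊗ Y))⁻¹ ∘ (P ◁ α X Q Y) ∘ α P (X ⊗ Q) Y ∘ f =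
   α (P ⊗ X) Q Y ∘ ((α P X Q)⁻¹ ▷ Y) ∘ f.
  by have := congr1 (fun h => h ∘ f) (pentagon4 P X Q Y); rewrite ?compA.
rewrite E4 (compAl (esym (assoc_natl _ _ _))) ?compA (compAl (pentagon _ _ _ _)) ?compA.
by rewrite !wl_comp !wr_comp ?compA.
Qed.

Definition ztens : zob := ZOb (HalfBraiding tens_hb_nat tens_hb_unit tens_hb_tens).
Lemma ztens_hbE X : zhb ztens X =
  α X (zcar Z) (zcar W) ∘ (z X ▷ zcar W) ∘ (α (zcar Z) X (zcar W))⁻¹ ∘
  (zcar Z ◁ w X) ∘ α (zcar Z) (zcar W) X :> mor _ _.
Proof. by []. Qed.
End ZTens.

Fact ztmor_compat (Z Z' W W' : zob) (f : zhom Z Z') (g : zhom W W') :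
  @hb_compat (ztens Z W) (ztens Z' W') (zval f ⊗₁ zval g).
Proof.
move=> X; rewrite !ztens_hbE ?compA.
rewrite assoc_nat.
rewrite (compAl (p := (zval f ⊗₁ (X ◁ zval g)) ∘ (zcar Z ◁ zhb W X))); last first.
  by rewrite -!tmor_comp comp1f compf1 zvalP.
rewrite compA (compAl (p := ((zval f ▷ X) ⊗₁ zval g) ∘ (α _ _ _)⁻¹)); last first.
  by apply/esym/iso_conj; rewrite assoc_nat.
rewrite compA (compAl (p := ((X ◁ zval f) ⊗₁ zval g) ∘ (zhb Z X ▷ zcar W))); last first.
  by rewrite -!tmor_comp comp1f compf1 zvalP.
by rewrite compA (compAl (assoc_nat _ _ _)) compA.
Qed.
Definition ztmor Z Z' W W' (f : zhom Z Z') (g : zhom W W') :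
  zhom (ztens Z W) (ztens Z' W') := zmk (ztmor_compat f g).

Definition unit_hb (X : C) : iso (𝟙 ⊗ X) (X ⊗ 𝟙) := iso_comp (iso_sym (ρ X)) (λ X).
Fact unit_hb_nat X Y (f : mor X Y) : unit_hb Y ∘ (𝟙 ◁ f) = (f ▷ 𝟙) ∘ unit_hb X.
Proof. by rewrite /= compA lunit_nat -!compA (iso_conj (runit_nat f)). Qed.
Fact unit_hb_unit : λ 𝟙 ∘ unit_hb 𝟙 = ρ (𝟙 : C).
Proof. by rewrite /= -compA {1}lunit_unit bwdK comp1f lunit_unit. Qed.
Fact unit_hb_tens X Y :
  α X Y 𝟙 ∘ unit_hb (X ⊗ Y) ∘ α 𝟙 X Y = (X ◁ unit_hb Y) ∘ α X 𝟙 Y ∘ (unit_hb X ▷ Y).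
Proof.
rewrite /= ?compA lunit_tens wl_comp wr_comp ?compA (compAl (triangle _ _)).
rewrite (compAl (wrKV _ _)) comp1f -compA; congr (_ ∘ _).
apply: (iso_mono (i := wl_iso X (ρ Y))) => /=.
rewrite -compA runit_tens bwdK wlKV //.
Qed.
Definition zunit : zob := ZOb (HalfBraiding unit_hb_nat unit_hb_unit unit_hb_tens).

Fact zassoc_compat (Z W V : zob) :
  @hb_compat (ztens (ztens Z W) V) (ztens Z (ztens W V)) (α (zcar Z) (zcar W) (zcar V)).
Proof.
move=> X; rewrite !ztens_hbE.
set P := zcar Z; set Q := zcar W; set R := zcar V.
set z := zhb Z X; set w := zhb W X; set v := zhb V X.
rewrite !wl_comp !wr_comp ?compA.
rewrite -[in LHS]pentagon.
have E1 U (f : mor U _) : (α P X (Q ⊗ R))⁻¹ ∘ (P ◁ α X Q R) ∘ f =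
   α (P ⊗ X) Q R ∘ ((α P X Q)⁻¹ ▷ R) ∘ (α P (X ⊗ Q) R)⁻¹ ∘ f.
  rewrite -!compA; congr (_ ∘ _); rewrite compA.
  apply: (iso_epi (i := α P (X ⊗ Q) R)).
  by rewrite ?compA pentagon4 fwdK compf1.
rewrite E1 ?compA (compAl (esym (assoc_natl _ _ _))) ?compA.
rewrite (compAl (esym (associ_natm _ _ _))) ?compA.
rewrite (compAl (pentagon _ _ _ _)) ?compA.
do 5 (congr (_ ∘ _)).
have E2 U (f : mor U _) : (α P (Q ⊗ X) R)⁻¹ ∘ (P ◁ (α Q X R)⁻¹) ∘ f =
   (α P Q X ▷ R) ∘ (α (P ⊗ Q) X R)⁻¹ ∘ (α P Q (X ⊗ R))⁻¹ ∘ f.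
  rewrite -!compA; congr (_ ∘ _); rewrite compA pentagonV.
  by rewrite -[RHS]compA wrKV comp1f.
rewrite E2 (compAl (esym (associ_natr _ _ _))) ?compA.
by rewrite (compAl (fwdK _)) comp1f.
Qed.

Fact zlunit_compat (Z : zob) : @hb_compat (ztens zunit Z) Z (λ (zcar Z)).
Proof.
move=> X; rewrite ztens_hbE /= wr_comp !compA (compAl (triangle _ _)).
rewrite (compAl (wrKV _ _)) comp1f -(lunit_tens X) !compA (compAl (bwdK _)) comp1f.
by rewrite (compAl (lunit_nat _)) compA lunit_tens.
Qed.
Fact zrunit_compat (Z : zob) : @hb_compat (ztens Z zunit) Z (ρ (zcar Z)).
Proof.
move=> X; rewrite ztens_hbE /= wl_comp !compA (compAl (runit_tens _ _)).
rewrite (compAl (runit_nat _)) compA -runit_tens compA (compAl (bwdK _)) comp1f.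
by rewrite (compAl (wlKV _ _)) comp1f triangle.
Qed.

Definition centre_mon : monoidal k.
Proof.
refine (@Monoidal k centre_cat ztens ztmor zunit
  (fun X Y Z => ziso (zassoc_compat X Y Z)) (fun X => ziso (zlunit_compat X))
  (fun X => ziso (zrunit_compat X)) _ _ _ _ _ _ _ _ _).
- by abstract by move=> X Y; apply: zval_inj; rewrite /= tmor_id.
- by abstract by move=> *; apply: zval_inj; rewrite /= tmor_comp.
- by abstract by move=> X X' Y Y' g a f f'; apply: zval_inj; rewrite zval_lin /= -tmor_linl -zval_lin.
- by abstract by move=> X X' Y Y' f a g g'; apply: zval_inj; rewrite zval_lin /= -tmor_linr -zval_lin.
- by abstract by move=> *; apply: zval_inj; rewrite /= assoc_nat.
- by abstract by move=> *; apply: zval_inj; rewrite /= lunit_nat.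
- by abstract by move=> *; apply: zval_inj; rewrite /= runit_nat.
- by abstract by move=> *; apply: zval_inj; rewrite /= pentagon.
- by abstract by move=> *; apply: zval_inj; rewrite /= triangle.
Defined.

Fact zbraid_compat (Z W : zob) :
  @hb_compat (ztens Z W) (ztens W Z) (zhb Z (zcar W)).
Proof.
move=> X; have Ez : α X (zcar W) (zcar Z) ∘ zhb Z (X ⊗ zcar W) =
    (X ◁ zhb Z (zcar W)) ∘ α X (zcar Z) (zcar W) ∘ (zhb Z X ▷ zcar W) ∘
    (α (zcar Z) X (zcar W))⁻¹.
  apply: (iso_epi (i := α (zcar Z) X (zcar W))).
  by rewrite !compA fwdK compf1 hb_tens.
rewrite !ztens_hbE !compA -hb_tens.
by rewrite (compAl (fwdK _)) comp1f (compAl (esym (hb_nat _ _))) !compA (compAl Ez) !compA.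
Qed.

Definition centre : braided k.
Proof.
refine (@Braided k centre_mon (fun Z W => ziso (zbraid_compat Z W)) _ _ _).
- abstract (move=> X X' Y Y' f g; apply: zval_inj => /=;
  rewrite [zval f ⊗₁ _]tmorE (compAl (zvalP f _)) compA hb_nat -compA;
  by rewrite -tmorE').
- by abstract by move=> X Y Z; apply: zval_inj; rewrite /= hb_tens.
- abstract (move=> X Y Z; apply: zval_inj;
  rewrite [zval _]/= [RHS]/= [in LHS]/= !compA;
  by rewrite (compAl (fwdK _)) comp1f bwdK compf1).
Defined.

Definition forget : functor centre C :=
  @Functor k centre C zcar zval (fun=> erefl) (fun _ _ _ _ _ => erefl) zval_lin.

Definition full_central (A : algebra C) (Z : centre) (zeta : mor (forget Z) A) :=
  alg_mul A ∘ (zeta ▷ A) = alg_mul A ∘ (A ◁ zeta) ∘ zhb Z A.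

Definition forget_alg (B : algebra centre) : algebra C :=
  @Algebra k C (forget B) (fmap forget (alg_mul B)) (fmap forget (alg_unit B))
    (congr1 (@zval _ _) (alg_mulA B)) (congr1 (@zval _ _) (alg_mul1l B))
    (congr1 (@zval _ _) (alg_mul1r B)).

(* The terminal pair (Z, ζ), with an algebra structure on Z for which ζ is a
   homomorphism. *)
Definition is_full_centre (A : algebra C) (Z : algebra centre) (zeta : mor (forget Z) A) :=
  [/\ @full_central A Z zeta,
      forall (Y : centre) (eta : mor (forget Y) A), @full_central A Y eta ->
        exists! f : mor Y Z, zeta ∘ fmap forget f = eta
    & @is_alg_hom k C (forget_alg Z) A zeta].
End Centre.

Definition left_dual_axioms (k : fieldType) (C : monoidal k) (X X' : C)
    (ev : mor (X' ⊗ X) 𝟙) (coev : mor 𝟙 (X ⊗ X')) :=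
  ρ X ∘ (X ◁ ev) ∘ α X X' X ∘ (coev ▷ X) = λ X /\
  λ X' ∘ (ev ▷ X') ∘ (α X' X X')⁻¹ ∘ (X' ◁ coev) = ρ X'.

(* Only left duals are recorded: for the braided categories considered here they
   are also right duals. *)
Record rigid (k : fieldType) (C : monoidal k) := Rigid {
  ldual : C -> C;
  ev : forall X, mor (ldual X ⊗ X) 𝟙;
  coev : forall X, mor 𝟙 (X ⊗ ldual X);
  dual_axioms : forall X, left_dual_axioms (ev X) (coev X)
}.

Definition dualm (k : fieldType) (C : monoidal k) (D : rigid C) (X Y : C) (f : mor X Y) :
    mor (ldual D Y) (ldual D X) :=
  λ (ldual D X) ∘ (ev D Y ▷ ldual D X) ∘ ((ldual D Y ◁ f) ▷ ldual D X) ∘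
  (α (ldual D Y) X (ldual D X))⁻¹ ∘ (ldual D Y ◁ coev D X) ∘ (ρ (ldual D Y))⁻¹.

(* A right adjoint of F with object function R, given by universal arrows. *)
Record right_adjoint (k : fieldType) (D C : category k) (F : functor D C) (R : C -> D) :=
  RightAdjoint {
  counit : forall X : C, mor (F (R X)) X;
  transpose : forall (Z : D) (X : C), mor (F Z) X -> mor Z (R X);
  transposeK : forall (Z : D) (X : C) (f : mor (F Z) X),
    counit X ∘ fmap F (transpose f) = f;
  transpose_counit : forall (Z : D) (X : C) (g : mor Z (R X)),
    transpose (counit X ∘ fmap F g) = g
}.
Arguments counit {k D C F R} r X : rename.
Arguments transpose {k D C F R} r {Z X} f : rename.

Section AdjointAlgebra.
Variables (k : fieldType) (C : monoidal k) (R : C -> centre C).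
Variable adj : right_adjoint (forget C) R.
Let F := forget C.

Definition radj_map (X Y : C) (f : mor X Y) : mor (R X) (R Y) :=
  transpose adj (f ∘ counit adj X : mor (F (R X)) Y).

(* The forgetful functor is strict monoidal; these are the mates of its
   (identity) structure morphisms. *)
Definition radj_tens (X Y : C) : mor (R X ⊗ R Y) (R (X ⊗ Y)) :=
  transpose adj (counit adj X ⊗₁ counit adj Y : mor (F (R X ⊗ R Y)) (X ⊗ Y)).
Definition radj_unit : mor 𝟙 (R 𝟙) :=
  transpose adj (mid 𝟙 : mor (F (𝟙 : centre C)) 𝟙).

Lemma radj_inj (Z : centre C) X (f g : mor Z (R X)) :
  counit adj X ∘ fmap F f = counit adj X ∘ fmap F g -> f = g.
Proof. by move=> E; rewrite -[f](transpose_counit adj) E transpose_counit. Qed.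

Variable A : algebra C.
Definition radj_mul : mor (R A ⊗ R A) (R A) := radj_map (alg_mul A) ∘ radj_tens A A.
Definition radj_one : mor 𝟙 (R A) := radj_map (alg_unit A) ∘ radj_unit.

Lemma counit_mul :
  counit adj A ∘ fmap F radj_mul = alg_mul A ∘ (counit adj A ⊗₁ counit adj A).
Proof. by rewrite fmap_comp (compAl (transposeK _ _)) compA transposeK. Qed.
Lemma counit_one : counit adj A ∘ fmap F radj_one = alg_unit A.
Proof. by rewrite fmap_comp (compAl (transposeK _ _)) compA transposeK compf1. Qed.

Fact radj_mulA : radj_mul ∘ (radj_mul ▷ R A) =
  radj_mul ∘ (R A ◁ radj_mul) ∘ α (R A) (R A) (R A).
Proof.
apply: radj_inj; rewrite !fmap_comp !(compAl counit_mul) !compA.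
set e := counit adj A.
rewrite -[fmap F (radj_mul ▷ _)]/(fmap F radj_mul ▷ F (R A)).
rewrite -[fmap F (_ ◁ radj_mul)]/(F (R A) ◁ fmap F radj_mul).
rewrite -[fmap F (fwd (α _ _ _))]/(fwd (α (F (R A)) (F (R A)) (F (R A)))).
have -> : (e ⊗₁ e) ∘ (fmap F radj_mul ▷ F (R A)) = (alg_mul A ▷ A) ∘ ((e ⊗₁ e) ⊗₁ e).
  by rewrite -!tmor_comp counit_mul comp1f compf1.
rewrite (compAl (p := (A ◁ alg_mul A) ∘ (e ⊗₁ (e ⊗₁ e)))); last first.
  by rewrite -!tmor_comp counit_mul comp1f compf1.
by rewrite !compA -assoc_nat (compAl (alg_mulA A)) !compA.
Qed.
Fact radj_mul1l : radj_mul ∘ (radj_one ▷ R A) = λ (R A).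
Proof.
apply: radj_inj; rewrite !fmap_comp !(compAl counit_mul) !compA.
set e := counit adj A.
rewrite -[fmap F (radj_one ▷ _)]/(fmap F radj_one ▷ F (R A)).
rewrite -[fmap F (fwd (λ _))]/(fwd (λ (F (R A)))).
rewrite -tmor_comp counit_one compf1 tmorE (compAl (alg_mul1l A)).
by rewrite lunit_nat.
Qed.
Fact radj_mul1r : radj_mul ∘ (R A ◁ radj_one) = ρ (R A).
Proof.
apply: radj_inj; rewrite !fmap_comp !(compAl counit_mul) !compA.
set e := counit adj A.
rewrite -[fmap F (_ ◁ radj_one)]/(F (R A) ◁ fmap F radj_one).
rewrite -[fmap F (fwd (ρ _))]/(fwd (ρ (F (R A)))).
rewrite -tmor_comp counit_one compf1 tmorE' (compAl (alg_mul1r A)).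
by rewrite runit_nat.
Qed.

Definition radj_alg : algebra (centre C) := Algebra radj_mulA radj_mul1l radj_mul1r.
End AdjointAlgebra.

Section Iota.
Variables (k : fieldType) (C : braided k).

Lemma hb_unit_of (Z : C) (z : forall X : C, iso (Z ⊗ X) (X ⊗ Z)) :
  (forall (X Y : C) (f : mor X Y), z Y ∘ (Z ◁ f) = (f ▷ Z) ∘ z X) ->
  (forall X Y : C,
    α X Y Z ∘ z (X ⊗ Y) ∘ α Z X Y = (X ◁ z Y) ∘ α X Z Y ∘ (z X ▷ Y)) ->
  λ Z ∘ z 𝟙 = ρ Z.
Proof.
move=> zn zt; apply: runit_inj; apply: (iso_mono (i := z 𝟙)).
rewrite -[ρ Z ▷ 𝟙]triangle (compAl (zn _ _ _)) !compA.
rewrite wr_comp -lunit_tens !compA.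
rewrite (compAl (esym (lunit_nat (z 𝟙)))) !compA -zt.
by rewrite (compAl (lunit_tens _ _)).
Qed.

Fact plus_nat (Z X Y : C) (f : mor X Y) : braid Z Y ∘ (Z ◁ f) = (f ▷ Z) ∘ braid Z X.
Proof. exact: braid_nat. Qed.
Definition plus_hb (Z : C) : half_braiding Z :=
  HalfBraiding (@plus_nat Z) (hb_unit_of (@plus_nat Z) (hexagon1 Z)) (hexagon1 Z).

Fact minus_nat (Z X Y : C) (f : mor X Y) :
  (braid Y Z)⁻¹ ∘ (Z ◁ f) = (f ▷ Z) ∘ (braid X Z)⁻¹.
Proof. by apply/esym/iso_conj/braid_nat. Qed.
Fact minus_tens (Z X Y : C) :
  α X Y Z ∘ (braid (X ⊗ Y) Z)⁻¹ ∘ α Z X Y =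
  (X ◁ (braid Y Z)⁻¹) ∘ α X Z Y ∘ ((braid X Z)⁻¹ ▷ Y).
Proof.
apply: (iso_mono (i := wl_iso X (braid Y Z))); rewrite /= -[RHS]compA wlKV comp1f.
apply: (iso_mono (i := iso_sym (α X Z Y))); rewrite /= -[RHS]compA fwdK comp1f.
apply: (iso_mono (i := wr_iso Y (braid X Z))); rewrite /= wrKV.
have H V (f : mor V _) : (braid X Z ▷ Y) ∘ (α X Z Y)⁻¹ ∘ (X ◁ braid Y Z) ∘ f =
    (α Z X Y)⁻¹ ∘ braid (X ⊗ Y) Z ∘ (α X Y Z)⁻¹ ∘ f.
  by have := congr1 (fun h => h ∘ f) (hexagon2 X Y Z); rewrite !compA => ->.
by rewrite H (compAl (fwdK _)) comp1f (compAl (bwdK _)) comp1f fwdK.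
Qed.
Definition minus_hb (Z : C) : half_braiding Z :=
  @HalfBraiding _ _ Z (fun X => iso_sym (braid X Z)) (@minus_nat Z)
    (@hb_unit_of Z (fun X => iso_sym (braid X Z)) (@minus_nat Z) (@minus_tens Z))
    (@minus_tens Z).

Definition zplus (X : C) : centre C := ZOb (plus_hb X).
Definition zminus (X : C) : centre C := ZOb (minus_hb X).

Fact zplus_compat (X Y : C) (f : mor X Y) : @hb_compat _ _ (zplus X) (zplus Y) f.
Proof. by move=> Z; rewrite /= braid_nat. Qed.
Fact zminus_compat (X Y : C) (f : mor X Y) : @hb_compat _ _ (zminus X) (zminus Y) f.
Proof. by move=> Z; apply/esym/iso_conj/braid_nat. Qed.

Definition zplusm (X Y : C) (f : mor X Y) : mor (zplus X) (zplus Y) :=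
  zmk (@zplus_compat X Y f).
Definition zminusm (X Y : C) (f : mor X Y) : mor (zminus X) (zminus Y) :=
  zmk (@zminus_compat X Y f).

Definition iota_plus : functor C (centre C).
Proof.
apply: (@Functor k C (centre C) zplus zplusm) => [X|X Y Z g f|X Y a f g].
- by abstract by apply: zval_inj.
- by abstract by apply: zval_inj.
- by abstract by apply: zval_inj; rewrite zval_lin.
Defined.
Definition iota_minus : functor C (centre C).
Proof.
apply: (@Functor k C (centre C) zminus zminusm) => [X|X Y Z g f|X Y a f g].
- by abstract by apply: zval_inj.
- by abstract by apply: zval_inj.
- by abstract by apply: zval_inj; rewrite zval_lin.
Defined.
End Iota.

Section PlusMinus.
Variables (k : fieldType) (C : braided k).
Definition plus_minus (X Y : C) : centre C := iota_plus C X ⊗ iota_minus C Y.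
Definition plus_minusm (X X' Y Y' : C) (f : mor X X') (g : mor Y Y') :
    mor (plus_minus X Y) (plus_minus X' Y') :=
  fmap (iota_plus C) f ⊗₁ fmap (iota_minus C) g.
End PlusMinus.

(* The functor C ⊠ C -> Z(C) is the k-linear functor, determined up to natural
   isomorphism by its values on the objects X ⊠ Y, with
   X ⊠ Y |-> ι₊(X) ⊗ ι₋(Y). *)
Definition is_nondegenerate (k : fieldType) (C : braided k) :=
  exists (Phi : functor (deligne C C) (centre C))
         (phi : forall X Y : C, iso (Phi (dbox X Y)) (plus_minus X Y)),
    (forall (X X' Y Y' : C) (f : mor X X') (g : mor Y Y'),
       phi X' Y' ∘ fmap Phi (dboxm f g) = plus_minusm f g ∘ phi X Y) /\
    is_equivalence Phi.

Record ribbon (k : fieldType) (C : braided k) (D : rigid C) := Ribbon {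
  twist : forall X : C, iso X X;
  twist_nat : forall (X Y : C) (f : mor X Y), twist Y ∘ f = f ∘ twist X;
  twist_tens : forall X Y : C,
    twist (X ⊗ Y) = (twist X ⊗₁ twist Y) ∘ braid Y X ∘ braid X Y :> mor _ _;
  twist_dual : forall X : C, twist (ldual D X) = dualm D (twist X) :> mor _ _
}.

Record modular (k : fieldType) := Modular {
  mod_cat :> braided k;
  mod_rigid : rigid mod_cat;
  mod_ribbon : ribbon mod_rigid;
  mod_semisimple : is_semisimple mod_cat;
  mod_nondegenerate : is_nondegenerate mod_cat
}.

(* P, Pm are the object and morphism functions of a functor C^op × C -> D. *)
Section Coend.
Variables (k : fieldType) (C D : category k) (P : C -> C -> D).
Variable Pm : forall X X' Y Y' : C, mor X' X -> mor Y Y' -> mor (P X Y) (P X' Y').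

Definition dinatural (W : D) (j : forall Y : C, mor (P Y Y) W) :=
  forall (Y Y' : C) (f : mor Y Y'), j Y ∘ Pm f (mid Y) = j Y' ∘ Pm (mid Y') f.

Definition is_coend (W : D) (j : forall Y : C, mor (P Y Y) W) :=
  dinatural j /\
  forall (V : D) (i : forall Y : C, mor (P Y Y) V), dinatural i ->
    exists! f : mor W V, forall Y, f ∘ j Y = i Y.
End Coend.

Section Rtilde.
Variables (k : fieldType) (C : modular k).
Notation "X ^∨" := (ldual (mod_rigid C) X) (at level 2, format "X ^∨").

Definition is_Rtilde (W : centre C)
    (j : forall Y : C, mor (iota_plus C Y^∨ ⊗ iota_minus C Y) W) :=
  @is_coend k C (centre C) (fun X Y : C => iota_plus C X^∨ ⊗ iota_minus C Y)
    (fun X X' Y Y' (f : mor X' X) (g : mor Y Y') =>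
       fmap (iota_plus C) (dualm (mod_rigid C) f) ⊗₁ fmap (iota_minus C) g) W j.
End Rtilde.

(* Main.v *)
Require Import Defs.
From HB Require Import structures.
From mathcomp Require Import all_boot all_order all_algebra.
From mathcomp Require Import boolp.

Set Implicit Arguments.
Unset Strict Implicit.
Unset Printing Implicit Defensive.

(* [Defs] is imported again because [compA] is shadowed by ssrfun. *)
Import GRing.Theory VectorInternalTheory Defs.
Local Open Scope ring_scope.
Local Open Scope cat_scope.

(* Write F for the forgetful functor.  If R is right adjoint to F with counit ε,
   then f : Y -> R(A) is left central if and only if ε ∘ F f is full central,
   because ε at A is a split epimorphism; so both terminal objects coincide, and
   they exist as the kernel of a morphism out of R(A), computed in C.

   That ι₊(-) ⊗ Rt is right adjoint to F reduces, by duality in C, to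
   Hom(Z, Rt) = Hom(F Z, 𝟙), and by non-degeneracy to Z = ι₊(P) ⊗ ι₋(Q).  For a
   simple S the dual bases of Hom(S, Y) and Hom(Y, S) define t : Rt -> S^∨ ⊠ S
   with t ∘ j S = 1 and t ∘ j S' = 0 for S' not isomorphic to S.  The idempotents
   j S ∘ t are orthogonal in the finite-dimensional End(Rt), so there are finitely
   many simple objects and the sum of these idempotents is 1.  Hence every
   morphism ι₊(P) ⊗ ι₋(Q) -> Rt factors as j Q ∘ (h ⊗ Q) with h : P -> Q^∨. *)

(** * Transposition of morphisms along a left dual *)

Section Duality.
Variables (k : fieldType) (C : monoidal k) (X X' : C).
Variables (ev : mor (X' ⊗ X) 𝟙) (coev : mor 𝟙 (X ⊗ X')).
Hypothesis dual : left_dual_axioms ev coev.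
Implicit Types V W Z : C.

(** [ltr] and [luntr] are the adjunction Hom(V, X ⊗ Z) ≅ Hom(X' ⊗ V, Z); [rtr] and [runtr] are Hom(V
    ⊗ X, W) ≅ Hom(V, W ⊗ X'). *)
Definition ltr V Z (g : mor V (X ⊗ Z)) : mor (X' ⊗ V) Z :=
  λ Z ∘ (ev ▷ Z) ∘ (α X' X Z)⁻¹ ∘ (X' ◁ g).
Definition luntr V Z (h : mor (X' ⊗ V) Z) : mor V (X ⊗ Z) :=
  (X ◁ h) ∘ α X X' V ∘ (coev ▷ V) ∘ (λ V)⁻¹.
Definition rtr V W (f : mor (V ⊗ X) W) : mor V (W ⊗ X') :=
  (f ▷ X') ∘ (α V X X')⁻¹ ∘ (V ◁ coev) ∘ (ρ V)⁻¹.
Definition runtr V W (g : mor V (W ⊗ X')) : mor (V ⊗ X) W :=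
  ρ W ∘ (W ◁ ev) ∘ α W X' X ∘ (g ▷ X).

Lemma ltr_natr V Z Z' (g : mor V (X ⊗ Z)) (u : mor Z Z') :
  ltr ((X ◁ u) ∘ g) = u ∘ ltr g.
Proof.
rewrite /ltr wl_comp (compAl (esym (associ_natr _ _ _))) ?compA.
rewrite (compAl (tmor_interchange ev u)) ?compA.
by rewrite (compAl (lunit_nat u)) ?compA.
Qed.
Lemma luntr_natr V Z Z' (h : mor (X' ⊗ V) Z) (u : mor Z Z') :
  luntr (u ∘ h) = (X ◁ u) ∘ luntr h.
Proof. by rewrite /luntr wl_comp ?compA. Qed.
Lemma rtr_natl V V' W (f : mor (V' ⊗ X) W) (u : mor V V') :
  rtr (f ∘ (u ▷ X)) = rtr f ∘ u.
Proof.
rewrite /rtr wr_comp ?compA (compAl (associ_natl _ _ u)) ?compA.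
rewrite (compAl (tmor_interchange u coev)) ?compA.
by rewrite (iso_conj (runit_nat u)).
Qed.

(** In all four inversion lemmas naturality extracts the given morphism, leaving a zigzag identity
    tensored with an object: the one for [X] here and in [rtrK], the one for [X'] in [luntrK] and
    [runtrK]. *)
Lemma ltrK V Z (g : mor V (X ⊗ Z)) : luntr (ltr g) = g.
Proof.
rewrite /luntr /ltr !wl_comp ?compA.
rewrite (compAl (esym (assoc_natr _ _ g))) ?compA.
rewrite (compAl (esym (tmor_interchange coev g))) ?compA.
rewrite (iso_conj (lunit_nat g)) -!compA -[RHS]comp1f; congr (_ ∘ _); rewrite ?compA.
apply: (iso_epi (i := λ _)); rewrite ?compA fwdK compf1 comp1f.
apply: (iso_epi (i := α _ _ _)); rewrite ?compA lunit_tens -assoc_natl.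
rewrite (compAl (pentagon _ _ _ _)) ?compA (compAl (wlK _ _)) comp1f.
rewrite (compAl (esym (assoc_natm _ _ ev))) ?compA.
by rewrite (compAl (triangle _ _)) -!wr_comp (proj1 dual).
Qed.
Lemma luntrK V Z (h : mor (X' ⊗ V) Z) : ltr (luntr h) = h.
Proof.
rewrite /luntr /ltr !wl_comp.
rewrite (compAl (esym (associ_natr _ _ h))) ?compA.
rewrite (compAl (tmor_interchange ev h)) ?compA.
rewrite (compAl (lunit_nat h)) ?compA -[RHS]compf1; congr (_ ∘ _).
apply: (iso_epi (i := wl_iso X' (λ V))); rewrite /= ?compA wlK compf1 comp1f.
apply: (iso_epi (i := α _ _ _)); rewrite ?compA triangle -assoc_natm.
have P4 U (f : mor U _) : (α X' X (X' ⊗ V))⁻¹ ∘ (X' ◁ α X X' V) ∘ α X' (X ⊗ X') V ∘ f =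
    α (X' ⊗ X) X' V ∘ ((α X' X X')⁻¹ ▷ V) ∘ f.
  by have := congr1 (fun h => h ∘ f) (pentagon4 X' X X' V); rewrite ?compA.
rewrite P4 (compAl (esym (assoc_natl _ _ ev))) ?compA (compAl (lunit_tens _ _)).
by rewrite -!wr_comp (proj2 dual).
Qed.

Lemma rtrK V W (f : mor (V ⊗ X) W) : runtr (rtr f) = f.
Proof.
rewrite /runtr /rtr !wr_comp ?compA.
rewrite (compAl (assoc_natl _ _ f)) ?compA.
rewrite (compAl (esym (tmor_interchange f ev))) ?compA.
rewrite (compAl (runit_nat f)) ?compA -[RHS]compf1; congr (_ ∘ _).
apply: (iso_epi (i := wr_iso X (ρ V))); rewrite /= ?compA wrK compf1 comp1f.
have P3 U (f' : mor U _) : α (V ⊗ X) X' X ∘ ((α V X X')⁻¹ ▷ X) ∘ f' =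
    (α V X (X' ⊗ X))⁻¹ ∘ (V ◁ α X X' X) ∘ α V (X ⊗ X') X ∘ f'.
  by have := congr1 (fun h => h ∘ f') (pentagon4 V X X' X); rewrite ?compA => ->.
rewrite P3 assoc_natm ?compA.
rewrite (compAl (associ_natr _ _ ev)) ?compA.
rewrite -triangle -(proj1 dual) !wl_comp ?compA.
rewrite -runit_tens ?compA.
by rewrite (compAl (bwdK _)) comp1f.
Qed.
Lemma runtrK V W (g : mor V (W ⊗ X')) : rtr (runtr g) = g.
Proof.
rewrite /runtr /rtr !wr_comp ?compA.
rewrite (compAl (associ_natl _ _ g)) ?compA.
rewrite (compAl (tmor_interchange g coev)) ?compA.
rewrite (iso_conj (runit_nat g)) -!compA -[RHS]comp1f; congr (_ ∘ _); rewrite ?compA.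
apply: (iso_epi (i := ρ _)); rewrite ?compA fwdK compf1 comp1f.
apply: (iso_epi (i := iso_sym (α _ _ _))); rewrite /= ?compA.
rewrite (associ_natr _ _ coev).
have P3 U (f' : mor U _) : (α W X' X ▷ X') ∘ (α (W ⊗ X') X X')⁻¹ ∘ (α W X' (X ⊗ X'))⁻¹ ∘ f' =
    (α W (X' ⊗ X) X')⁻¹ ∘ (W ◁ (α X' X X')⁻¹) ∘ f'.
  rewrite (compAl (pentagonV _ _ _ _)) ?compA (compAl (wrKV _ _)) comp1f //.
rewrite P3 (compAl (associ_natm _ _ ev)) ?compA -triangle ?compA (compAl (bwdK _)) comp1f.
by rewrite -!wl_comp (proj2 dual) -runit_tens ?compA bwdK compf1.
Qed.

Lemma ltr_inj V Z (g g' : mor V (X ⊗ Z)) : ltr g = ltr g' -> g = g'.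
Proof. by move=> E; rewrite -[g]ltrK E ltrK. Qed.
Lemma rtr_inj V W (f f' : mor (V ⊗ X) W) : rtr f = rtr f' -> f = f'.
Proof. by move=> E; rewrite -[f]rtrK E rtrK. Qed.
Lemma runtr_inj V W (g g' : mor V (W ⊗ X')) : runtr g = runtr g' -> g = g'.
Proof. by move=> E; rewrite -[g]runtrK E runtrK. Qed.
End Duality.

(** * Linear maps and linear categories *)

Section LinearMaps.
Variables (k : fieldType) (U V : vectType k) (f : U -> V).
Hypothesis fL : linear f.

Lemma linear_predB u v : f (u - v) = f u - f v.
Proof. by rewrite -scaleN1r addrC fL scaleN1r addrC. Qed.
Lemma linear_predZ a u : f (a *: u) = a *: f u.
Proof. by rewrite -[a *: u]addr0 fL (linear_pred0 fL) addr0. Qed.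
Lemma linear_pred_sum (I : finType) (P : pred I) (F : I -> U) :
  f (\sum_(i | P i) F i) = \sum_(i | P i) f (F i).
Proof.
elim/big_rec2: _ => [|i y x _ <-]; first exact: linear_pred0.
exact: linear_predD.
Qed.
End LinearMaps.

Section LinearCategory.
Variables (k : fieldType) (C : category k).
Implicit Types X Y Z : C.

Lemma comp0f X Y Z (f : mor X Y) : 0 ∘ f = 0 :> mor X Z.
Proof. exact: (linear_pred0 (comp_linl f)). Qed.
Lemma compf0 X Y Z (g : mor Y Z) : g ∘ 0 = 0 :> mor X Z.
Proof. exact: (linear_pred0 (comp_linr g)). Qed.
Lemma compBf X Y Z (g g' : mor Y Z) (f : mor X Y) : (g - g') ∘ f = g ∘ f - g' ∘ f.
Proof. exact: (linear_predB (comp_linl f)). Qed.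
Lemma compfB X Y Z (g : mor Y Z) (f f' : mor X Y) : g ∘ (f - f') = g ∘ f - g ∘ f'.
Proof. exact: (linear_predB (comp_linr g)). Qed.
Lemma compZf X Y Z a (g : mor Y Z) (f : mor X Y) : (a *: g) ∘ f = a *: (g ∘ f).
Proof. exact: (linear_predZ (comp_linl f)). Qed.
Lemma compfZ X Y Z a (g : mor Y Z) (f : mor X Y) : g ∘ (a *: f) = a *: (g ∘ f).
Proof. exact: (linear_predZ (comp_linr g)). Qed.
Lemma comp_suml (I : finType) (P : pred I) X Y Z (g : I -> mor Y Z) (f : mor X Y) :
  (\sum_(i | P i) g i) ∘ f = \sum_(i | P i) g i ∘ f.
Proof. exact: (linear_pred_sum (comp_linl f)). Qed.
Lemma comp_sumr (I : finType) (P : pred I) X Y Z (g : mor Y Z) (f : I -> mor X Y) :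
  g ∘ (\sum_(i | P i) f i) = \sum_(i | P i) g ∘ f i.
Proof. exact: (linear_pred_sum (comp_linr g)). Qed.

Lemma mono0P X Y (f : mor X Y) :
  (forall W (g : mor W X), f ∘ g = 0 -> g = 0) -> is_mono f.
Proof.
move=> H W g h E; apply/eqP; rewrite -subr_eq0; apply/eqP/H.
by rewrite compfB E subrr.
Qed.
Lemma kernel_mono X Y (f : mor X Y) K (i : mor K X) : is_kernel f i -> is_mono i.
Proof.
move=> [fi0 H] W g h E; have [|x [_ U]] := H _ (i ∘ g); first by rewrite -compA fi0 comp0f.
by rewrite -(U g) // -(U h).
Qed.
Lemma zero_dom X Y (f : mor X Y) : is_zero X -> f = 0.
Proof. by rewrite -[f]compf1 => ->; rewrite compf0. Qed.
Lemma zero_cod X Y (f : mor X Y) : is_zero Y -> f = 0.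
Proof. by rewrite -[f]comp1f => ->; rewrite comp0f. Qed.
End LinearCategory.

(** * The universal property of evaluation and dual morphisms *)

Section DualMorphisms.
Variables (k : fieldType) (C : monoidal k).

(** Pairing with [ev] is [runtr] with codomain [𝟙], up to a unit constraint. Bijectivity of [runtr]
    therefore makes [X^∨] represent V ↦ Hom(V ⊗ X, 𝟙). *)
Lemma ev_runtr (X X' V : C) (ev : mor (X' ⊗ X) 𝟙) (g : mor V X') :
  runtr ev ((λ X')⁻¹ ∘ g) = ev ∘ (g ▷ X).
Proof.
rewrite /runtr wr_comp -lunit_unit (compAl (lunit_nat ev)) ?compA.
by rewrite (compAl (lunit_tens _ _)) (compAl (wrKV _ _)) comp1f.
Qed.

Variable D : rigid C.
Notation "X ^∨" := (ldual D X) (at level 2, format "X ^∨").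

Lemma ev_inj (X V : C) (g g' : mor V X^∨) :
  ev D X ∘ (g ▷ X) = ev D X ∘ (g' ▷ X) -> g = g'.
Proof.
rewrite -!ev_runtr => /(runtr_inj (dual_axioms D X)).
exact: (@iso_mono _ _ _ _ (iso_sym _)).
Qed.
Lemma ev_surj (X V : C) (h : mor (V ⊗ X) 𝟙) :
  exists g : mor V X^∨, ev D X ∘ (g ▷ X) = h.
Proof.
exists (λ _ ∘ rtr (coev D X) h).
by rewrite -ev_runtr -compA fwdK comp1f (rtrK (dual_axioms D X)).
Qed.

(** By [ev_inj] this identity characterises [dualm D f]; functoriality and linearity of duals are
    derived from it. *)
Lemma ev_dualm (X Y : C) (f : mor X Y) :
  ev D X ∘ (dualm D f ▷ X) = ev D Y ∘ (Y^∨ ◁ f).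
Proof.
rewrite -ev_runtr /dualm -?compA fwdK comp1f ?compA.
rewrite -[RHS](rtrK (dual_axioms D X)).
by congr runtr; rewrite /rtr wr_comp ?compA.
Qed.

Lemma dualm_id (X : C) : dualm D (mid X) = mid X^∨.
Proof. by apply: ev_inj; rewrite ev_dualm. Qed.
Lemma dualm_comp (X Y Z : C) (g : mor Y Z) (f : mor X Y) :
  dualm D (g ∘ f) = dualm D f ∘ dualm D g.
Proof.
apply: ev_inj; rewrite ev_dualm wr_comp -compA ev_dualm compA -tmor_interchange.
by rewrite -compA ev_dualm compA -wl_comp.
Qed.
Lemma dualm_linear (X Y : C) : linear (@dualm _ _ D X Y).
Proof.
move=> a f g; apply: ev_inj.
by rewrite tmor_linl comp_linr !ev_dualm tmor_linr comp_linr.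
Qed.

Lemma ev_eq0 (X : C) : ev D X = 0 -> is_zero X.
Proof.
move=> ev0; have [E _] := dual_axioms D X.
apply: (iso_epi (i := λ X)); rewrite comp1f comp0f -E ev0.
by rewrite (linear_pred0 (tmor_linr _)) comp0f compf0.
Qed.
End DualMorphisms.

(* The maps [ti] and [tp] are dual bases of Hom(S, Y) and Hom(Y, S). *)
Record isotypic (k : fieldType) (C : category k) (S Y : C) := Isotypic {
  tn : nat;
  ti : 'I_tn -> mor S Y;
  tp : 'I_tn -> mor Y S;
  tiP : forall f : mor S Y, (\sum_a ti a ∘ tp a) ∘ f = f;
  tpP : forall g : mor Y S, g ∘ (\sum_a ti a ∘ tp a) = g
}.
Arguments ti {k C S Y} _ _.
Arguments tp {k C S Y} _ _.

(** * Schur's lemma and isotypic projections *)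

Section Semisimple.
Variables (k : fieldType) (C : category k).
Hypothesis ss : is_semisimple C.
Implicit Types S T X Y : C.

(** The kernel of [f] is zero, as otherwise its inclusion would be invertible and [f] zero. So [f]
    is a nonzero subobject of the simple [T]. *)
Lemma schur S T (f : mor S T) : is_simple S -> is_simple T -> f <> 0 -> is_iso f.
Proof.
case: ss => -[_ kerC _ _ _] _ _ [_ S_simple] [_ T_simple] f0.
have [K [i ki]] := kerC _ _ f; have [fi0 lift] := ki.
have zK : is_zero K.
  have [//|[g [_ ig1]]] := S_simple _ i (kernel_mono ki).
  by case: f0; rewrite -[f]compf1 -ig1 -compA fi0 comp0f.
have [|zS|//] := T_simple _ f; last by case: f0; apply: zero_dom.
apply: mono0P => W g /lift[h [<- _]].
by rewrite (zero_cod h zK) compf0.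
Qed.

Lemma schur0 S T : is_simple S -> is_simple T -> (forall f : mor S T, f = 0) ->
  forall g : mor T S, g = 0.
Proof.
move=> sS sT H g; apply: contrapT => g0.
have [f [fg _]] := schur sT sS g0.
by case: sT => zT _; apply: zT; rewrite /is_zero -fg (H f) comp0f.
Qed.

Lemma simple_dichotomy S T : is_simple S -> is_simple T ->
  (forall f : mor S T, f = 0) \/ exists f : mor S T, is_iso f.
Proof.
move=> sS sT; have [H|] := pselect (exists f : mor S T, f <> 0).
  by right; have [f /(schur sS sT)] := H; exists f.
by move=> H; left=> f; apply: contrapT => f0; apply: H; exists f.
Qed.

(** Decompose [Y] into simple summands: those isomorphic to [S] contribute their inclusion and
    projection, all others the pair (0, 0). *)
Lemma isotypic_ex S Y : is_simple S -> exists _ : isotypic S Y, True.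
Proof.
move=> sS; case: ss => _ /(_ Y)[n [U [sU [inj [pr [_ _ sum1]]]]]] _.
have H a : exists ip : mor S Y * mor Y S,
    (forall f : mor S Y, (ip.1 ∘ ip.2) ∘ f = inj a ∘ (pr a ∘ f)) /\
    (forall g : mor Y S, g ∘ (ip.1 ∘ ip.2) = (g ∘ inj a) ∘ pr a).
  have [U0|[f [g [gf fg]]]] := simple_dichotomy sS (sU a).
    exists (0, 0) => /=; rewrite comp0f; split=> u; rewrite ?comp0f ?compf0.
      by rewrite (U0 (pr a ∘ u)) compf0.
    by rewrite (schur0 sS (sU a) U0 (u ∘ inj a)) comp0f.
  exists (inj a ∘ f, g ∘ pr a) => /=; rewrite !compA (compAl fg) comp1f.
  by split=> u; rewrite compA.
have [ip ipP] := choice H.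
unshelve eexists; last by []; exists n (fun a => (ip a).1) (fun a => (ip a).2) => u.
  rewrite -[RHS]comp1f -sum1 !comp_suml; apply: eq_bigr => a _.
  by rewrite (proj1 (ipP a)) compA.
rewrite -[RHS]compf1 -sum1 !comp_sumr; apply: eq_bigr => a _.
by rewrite (proj2 (ipP a)) compA.
Qed.

Definition isotyp S (sS : is_simple S) Y : isotypic S Y := sval (cid (isotypic_ex Y sS)).

(** The projection of [Y] onto its [S]-isotypic component. *)
Definition isoproj S (sS : is_simple S) Y : mor Y Y :=
  \sum_a ti (isotyp sS Y) a ∘ tp (isotyp sS Y) a.

Lemma isoproj_id S (sS : is_simple S) Y (f : mor S Y) : isoproj sS Y ∘ f = f.
Proof. exact: tiP. Qed.
Lemma isoproj_iso S T (sS : is_simple S) Y (u : mor S T) (f : mor T Y) :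
  is_iso u -> isoproj sS Y ∘ f = f.
Proof.
move=> [v [_ uv]]; rewrite -[f]compf1 -uv -[f ∘ _]compA.
by rewrite -[LHS]compA isoproj_id.
Qed.
Lemma isoproj_disjoint S T (sS : is_simple S) Y (f : mor T Y) :
  (forall g : mor T S, g = 0) -> isoproj sS Y ∘ f = 0.
Proof.
move=> H; rewrite comp_suml big1 // => a _.
by rewrite compA (H (_ ∘ f)) compf0.
Qed.

Lemma simple_decomp Y : exists n (U : 'I_n -> C) (inj : forall a, mor (U a) Y)
    (pr : forall a, mor Y (U a)),
  (forall a, is_simple (U a)) /\ \sum_a inj a ∘ pr a = mid Y.
Proof.
by case: ss => _ /(_ Y)[n [U [sU [inj [pr [_ _ sum1]]]]]] _; exists n, U, inj, pr.
Qed.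

(** Each simple summand of [Y] is isomorphic to exactly one [T i], whose projection fixes it while
    the others kill it. *)
Lemma isoproj_sum n (T : 'I_n -> C) (sT : forall i, is_simple (T i)) Y :
  (forall i j, i != j -> forall f : mor (T i) (T j), f = 0) ->
  (forall S, is_simple S -> exists i (f : mor (T i) S), is_iso f) ->
  \sum_i isoproj (sT i) Y = mid Y.
Proof.
move=> disj cov; have [m [U [inj [pr [sU sum1]]]]] := simple_decomp Y.
rewrite -[LHS]compf1 -sum1 comp_sumr; apply: eq_bigr => a _.
rewrite -compA; congr (_ ∘ _).
have [i0 [f isof]] := cov _ (sU a).
rewrite comp_suml (bigD1 i0) //= (isoproj_iso _ _ isof) big1 ?addr0 // => i ii0.
apply: isoproj_disjoint => g; have [h [_ fh]] := isof.
rewrite -[g]compf1 -fh -compA.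
by rewrite (disj i0 i _ (g ∘ f)) 1?eq_sym // comp0f.
Qed.

Lemma simple_scalar S (f : mor S S) : is_simple S -> exists a : k, f = a *: mid S.
Proof. by case: ss => _ _ H /H. Qed.
End Semisimple.

(** * The coend as a finite sum over simple objects *)

Section DualCoend.
Variables (k : fieldType) (C : braided k) (D : rigid C).
Notation "X ^∨" := (ldual D X) (at level 2, format "X ^∨").

Definition dpm (X Y : C) : centre C := iota_plus C X^∨ ⊗ iota_minus C Y.
Definition dpmm (X X' Y Y' : C) (f : mor X' X) (g : mor Y Y') : mor (dpm X Y) (dpm X' Y') :=
  fmap (iota_plus C) (dualm D f) ⊗₁ fmap (iota_minus C) g.

Lemma dpmm_comp (X X' X'' Y Y' Y'' : C) (f : mor X' X) (f' : mor X'' X')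
    (g : mor Y Y') (g' : mor Y' Y'') :
  dpmm f' g' ∘ dpmm f g = dpmm (f ∘ f') (g' ∘ g).
Proof. by rewrite /dpmm -tmor_comp -!fmap_comp dualm_comp. Qed.
Lemma dpmm_id (X Y : C) : dpmm (mid X) (mid Y) = mid (dpm X Y).
Proof. by rewrite /dpmm dualm_id !fmap_id tmor_id. Qed.
Lemma dpmm_linl (X X' Y Y' : C) (g : mor Y Y') :
  linear (fun f : mor X' X => dpmm f g).
Proof. by move=> a f f'; rewrite /dpmm dualm_linear fmap_lin tmor_linl. Qed.
Lemma dpmm_linr (X X' Y Y' : C) (f : mor X' X) :
  linear (fun g : mor Y Y' => dpmm f g).
Proof. by move=> a g g'; rewrite /dpmm fmap_lin tmor_linr. Qed.

Definition dpm_dinatural (V : centre C) (i : forall Y, mor (dpm Y Y) V) :=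
  dinatural (fun X X' Y Y' f g => @dpmm X X' Y Y' f g) i.

Hypothesis ss : is_semisimple C.

Section Simple.
Variables (S : C) (sS : is_simple S).

(** The canonical element of Hom(S, Y) ⊗ Hom(Y, S), with the first factor acting through duals. *)
Definition isoev (Y : C) : mor (dpm Y Y) (dpm S S) :=
  \sum_a dpmm (ti (isotyp ss sS Y) a) (tp (isotyp ss sS Y) a).

(** Endomorphisms of [S] being scalars, [f] has a matrix [c] in the two isotypic bases. Expanding
    one side by [tiP] and the other by [tpP] gives the same double sum. *)
Lemma isoev_dinatural : dpm_dinatural isoev.
Proof.
move=> Y Y' f; rewrite /isoev !comp_suml.
set t := isotyp ss sS Y; set t' := isotyp ss sS Y'.
have [c cE] : exists c : 'I_(tn t) -> 'I_(tn t') -> k,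
    forall a b, tp t' b ∘ f ∘ ti t a = c a b *: mid S.
  have H a : exists c : 'I_(tn t') -> k, forall b, tp t' b ∘ f ∘ ti t a = c b *: mid S.
    have [|c cP] := @choice _ _ (fun b (x : k) => tp t' b ∘ f ∘ ti t a = x *: mid S).
      by move=> b; apply: (simple_scalar ss _ sS).
    by exists c.
  by have [c cP] := choice H; exists c.
transitivity (\sum_a \sum_b c a b *: dpmm (ti t' b) (tp t a)).
  apply: eq_bigr => a _; rewrite dpmm_comp compf1 -[f ∘ _](tiP t') comp_suml.
  rewrite (linear_pred_sum (@dpmm_linl _ _ _ _ _)); apply: eq_bigr => b _.
  by rewrite compA cE compfZ compf1 (linear_predZ (@dpmm_linl _ _ _ _ _)).
rewrite exchange_big; apply: eq_bigr => b _.
rewrite dpmm_comp comp1f -[X in dpmm _ X](tpP t) comp_sumr.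
rewrite (linear_pred_sum (@dpmm_linr _ _ _ _ _)); apply: eq_bigr => a _.
by rewrite -compA [(_ ∘ f) ∘ _]compA cE compZf comp1f (linear_predZ (@dpmm_linr _ _ _ _ _)).
Qed.

(** For [Y = S] each [ti a] is a scalar, which can be moved across the tensor product onto
    [tp a]. *)
Lemma isoev_simple : isoev S = mid (dpm S S).
Proof.
rewrite -dpmm_id -[X in dpmm _ X](@isoproj_id _ _ ss _ sS).
rewrite compf1 (linear_pred_sum (@dpmm_linr _ _ _ _ _)); apply: eq_bigr => a _.
have [c ->] := simple_scalar ss (ti (isotyp ss sS S) a) sS.
rewrite compZf comp1f (linear_predZ (@dpmm_linr _ _ _ _ _)).
by rewrite (linear_predZ (@dpmm_linl _ _ _ _ _)).
Qed.

Lemma isoev_disjoint (T : C) : (forall f : mor S T, f = 0) -> isoev T = 0.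
Proof.
move=> ST0; apply: big1 => a _.
by rewrite (ST0 (ti _ _)) (linear_pred0 (@dpmm_linl _ _ _ _ _)).
Qed.

(** Dinaturality moves each [ti a] from the dual leg to the other one, where it meets [tp a]. *)
Lemma dinatural_isoev (V : centre C) (i : forall Y, mor (dpm Y Y) V) Y :
  dpm_dinatural i -> i S ∘ isoev Y = i Y ∘ dpmm (mid Y) (isoproj ss sS Y).
Proof.
move=> di; rewrite comp_sumr (linear_pred_sum (@dpmm_linr _ _ _ _ _)) comp_sumr.
apply: eq_bigr => a _; set u := ti _ a; set p := tp _ a.
have -> : dpmm u p = dpmm u (mid S) ∘ dpmm (mid Y) p by rewrite dpmm_comp !comp1f.
by rewrite (compAl (di _ _ u)) compA dpmm_comp comp1f.
Qed.

Lemma ev_isoev Y :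
  ev D S ∘ fmap (forget C) (isoev Y) = ev D Y ∘ (Y^∨ ◁ isoproj ss sS Y).
Proof.
rewrite (linear_pred_sum (@fmap_lin _ _ _ (forget C) _ _)) comp_sumr.
rewrite (linear_pred_sum (@tmor_linr _ _ _ _ _ _ _)) comp_sumr.
apply: eq_bigr => a _.
rewrite -[fmap (forget C) _]/(dualm D (ti (isotyp ss sS Y) a) ⊗₁ tp (isotyp ss sS Y) a).
by rewrite tmorE (compAl (ev_dualm _ _)) compA -wl_comp.
Qed.
End Simple.

Variables (Rt : centre C) (j : forall Y : C, mor (dpm Y Y) Rt).
Hypothesis coend : is_coend (fun X X' Y Y' f g => @dpmm X X' Y Y' f g) j.

Lemma coend_hom_ex (V : centre C) (i : forall Y, mor (dpm Y Y) V) :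
  dpm_dinatural i -> exists f : mor Rt V, forall Y, f ∘ j Y = i Y.
Proof. by move=> /(proj2 coend)[f [fE _]]; exists f. Qed.
Lemma coend_inj (V : centre C) (f g : mor Rt V) :
  (forall Y, f ∘ j Y = g ∘ j Y) -> f = g.
Proof.
move=> E; have [|h [_ U]] := proj2 coend V (fun Y => g ∘ j Y).
  by move=> Y Y' u; rewrite !compA (proj1 coend).
by rewrite -(U f E) (U g).
Qed.

(** The projection of [Rt] onto its summand [S^∨ ⊠ S]. *)
Definition copr S (sS : is_simple S) : mor Rt (dpm S S) :=
  sval (cid (coend_hom_ex (isoev_dinatural sS))).
Lemma coprE S (sS : is_simple S) Y : copr sS ∘ j Y = isoev sS Y.
Proof. exact: (svalP (cid (coend_hom_ex (isoev_dinatural sS)))). Qed.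

(** The endomorphisms [e i] are linearly independent: composing a relation with [j (T i)] leaves
    only [c i *: j (T i)]. Here [j (T i)] is nonzero, as it is split by [copr] and the evaluation of
    [T i] is nonzero. *)
Lemma simple_family_bound n (T : 'I_n -> C) (sT : forall i, is_simple (T i)) :
  (forall i i', i != i' -> forall f : mor (T i) (T i'), f = 0) ->
  (n <= \dim {: @mor _ (centre C) Rt Rt})%N.
Proof.
move=> disj; pose e i : @mor _ (centre C) Rt Rt := j (T i) ∘ copr (sT i).
have ej i i' : e i ∘ j (T i') = if i == i' then j (T i) ∘ isoev (sT i) (T i') else 0.
  rewrite /e compA coprE; case: eqP => // /eqP ii'.
  by rewrite isoev_disjoint ?compf0 //; apply: disj.
have freee : free [tuple e i | i < n].
  apply/freeP => c c0 i.
  have : (\sum_i c i *: e i) ∘ j (T i) = 0.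
    have -> : \sum_i c i *: e i = 0; last exact: comp0f.
    rewrite -[RHS]c0; apply: eq_bigr => l _.
    by rewrite (nth_map l) ?size_enum_ord // nth_ord_enum.
  rewrite comp_suml (bigD1 i) // big1 => [|l li]; last first.
    by rewrite compZf ej (negPf li) scaler0.
  move/(etrans (esym (addr0 _))).
  rewrite compZf ej eqxx isoev_simple compf1 => cj0.
  apply: contrapT => /eqP ci0.
  have {cj0} j0 : j (T i) = 0.
    by rewrite -[j _]scale1r -(mulVf ci0) -scalerA cj0 scaler0.
  have := isoev_simple (sT i); rewrite -(coprE (sT i)) j0 compf0.
  move=> /(congr1 (@zval _ _ _ _)) id0; apply: (proj1 (sT i)); apply: (@ev_eq0 _ _ D).
  have {}id0 : mid ((T i)^∨ ⊗ T i) = 0 by exact: esym id0.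
  by rewrite -[ev D _]compf1 id0 compf0.
have := dimvS (subvf <<[tuple e i | i < n]>>%VS).
by move: freee; rewrite /free => /eqP ->; rewrite size_tuple.
Qed.
(** By the dimension bound there is a largest family of pairwise non-isomorphic simple objects; a
    simple object it misses would enlarge it. *)
Lemma simple_reps : exists n (T : 'I_n -> C) (sT : forall i, is_simple (T i)),
  forall Y, \sum_i isoproj ss (sT i) Y = mid Y.
Proof.
pose P n := `[< exists T : 'I_n -> C, (forall i, is_simple (T i)) /\
  forall i i', i != i' -> forall f : mor (T i) (T i'), f = 0 >].
(* The index type is empty, so [𝟙] is only a dummy value. *)
have exP : exists n, P n by exists 0%N; apply/asboolP; exists (fun=> 𝟙); split=> -[].
have ubP n : P n -> (n <= \dim {: @mor _ (centre C) Rt Rt})%N.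
  by move=> /asboolP[T [sT]]; apply: simple_family_bound.
case: (ex_maxnP exP ubP) => n /asboolP[T [sT disj]] maxn.
exists n, T, sT => Y; apply: isoproj_sum => // S sS.
apply: contrapT => notcov.
have TS0 i (f : mor (T i) S) : f = 0.
  apply: contrapT => f0; apply: notcov; exists i, f; exact: schur f0.
suff /maxn : P n.+1 by rewrite ltnn.
(* The enlarged family has [S] at index 0 and [T] shifted by one. *)
apply/asboolP; exists (fun i => if unlift ord0 i is Some i' then T i' else S).
split=> [i|i i']; first by case: unliftP.
case: unliftP => [l|] ->; case: unliftP => [l'|] -> //.
- by rewrite (inj_eq lift_inj); apply: disj.
by move=> _; apply: schur0 (TS0 l').
Qed.

(** Evaluations are morphisms in C, not in the centre, so the universal property of [Rt] does not
    apply to them. The map is assembled from finitely many simple components instead. *)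
Lemma coend_ev_ex : exists e : mor (forget C Rt) 𝟙,
  forall Y, e ∘ fmap (forget C) (j Y) = ev D Y.
Proof.
have [n [T [sT sum1]]] := simple_reps.
exists (\sum_i ev D (T i) ∘ fmap (forget C) (copr (sT i))) => Y.
rewrite -[RHS]compf1 -tmor_id -(sum1 Y) (linear_pred_sum (@tmor_linr _ _ _ _ _ _ _)).
rewrite comp_sumr comp_suml; apply: eq_bigr => i _.
rewrite compA -[fmap _ (copr _) ∘ _]/(fmap (forget C) (copr (sT i) ∘ j Y)).
by rewrite coprE ev_isoev.
Qed.

(** After composition with [j Y], dinaturality turns the terms into the isotypic projections of [Y],
    which sum to the identity. *)
Lemma coend_split : exists n (T : 'I_n -> C) (t : forall i, mor Rt (dpm (T i) (T i))),
  \sum_i j (T i) ∘ t i = mid Rt.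
Proof.
have [n [T [sT sum1]]] := simple_reps; exists n, T, (fun i => copr (sT i)).
apply: coend_inj => Y; rewrite comp_suml comp1f -[RHS]compf1 -dpmm_id -[X in dpmm _ X]sum1.
rewrite (linear_pred_sum (@dpmm_linr _ _ _ _ _)) comp_sumr; apply: eq_bigr => i _.
by rewrite compA coprE dinatural_isoev //; case: coend.
Qed.
End DualCoend.

(** * Generation of the centre by the objects ι₊(P) ⊗ ι₋(Q) *)

Lemma equivalence_full (k : fieldType) (C D : category k) (F : functor C D) :
  is_equivalence F -> forall X Y (m : mor (F X) (F Y)), exists f, fmap F f = m.
Proof.
case=> G [eta [eps [eta_nat eps_nat]]] X Y m.
exists (eta Y ∘ fmap G m ∘ (eta X)⁻¹).
set f := _ ∘ _.
(* Naturality of [eta] shows that [G] identifies [F f] with [m]; naturality of [eps] then cancels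
   [G]. *)
have FGf : fmap G (fmap F f) = fmap G m.
  apply: (iso_mono (i := eta Y)); apply: (iso_epi (i := iso_sym (eta X))) => /=.
  by rewrite eta_nat !compA bwdK compf1.
apply: (iso_epi (i := eps (F X))).
by rewrite -!eps_nat FGf.
Qed.

Lemma tens_span (k : fieldType) (U V : vectType k) (t : tens U V) :
  exists n (u : 'I_n -> U) (v : 'I_n -> V), t = \sum_i pure (u i) (v i).
Proof.
exists (dim U), (fun i => r2v (delta_mx 0 i)), (fun i => r2v (row i t)).
apply/matrixP => a b; rewrite summxE (bigD1 a) //= big1 => [|i ia].
  by rewrite addr0 /pure !r2vK mxE big_ord1 !mxE !eqxx mul1r.
by rewrite /pure !r2vK mxE big_ord1 !mxE eqxx (eq_sym a) (negPf ia) mul0r.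
Qed.

Lemma dbox_hom_span (k : fieldType) (C D : category k) (X X' : C) (Y Y' : D)
    (w : @mor _ (deligne C D) (dbox X Y) (dbox X' Y')) :
  exists n (a : 'I_n -> mor X X') (b : 'I_n -> mor Y Y'), w = \sum_i dboxm (a i) (b i).
Proof.
have [n [a [b E]]] := tens_span (w ord0 ord0); exists n, a, b.
apply: dhomP => i j; rewrite !fam_sumE [i]ord1 [j]ord1 E.
by apply: eq_bigr => l _; rewrite mkdhomE.
Qed.

(** Rows and columns of the identity matrix are the injections and projections of a formal direct
    sum. *)
Lemma dob_span (k : fieldType) (C D : category k) (S : deligne C D) :
  exists (u : forall i : 'I_(dn S), mor (dbox (dl i) (dr i)) S)
         (v : forall i : 'I_(dn S), mor S (dbox (dl i) (dr i))),
    \sum_i u i ∘ v i = mid S.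
Proof.
exists (fun i => @mkdhom k C D (dbox (dl i) (dr i)) S (fun _ j => did_entry i j)).
exists (fun i => @mkdhom k C D S (dbox (dl i) (dr i)) (fun j _ => did_entry j i)).
rewrite -[RHS](@dcomp1f k C D S S); apply: dhomP => a b.
rewrite !fam_sumE [RHS]mkdhomE; apply: eq_bigr => i _.
by rewrite mkdhomE big_ord1 !mkdhomE.
Qed.

Section Nondegenerate.
Variables (k : fieldType) (C : braided k).
Hypothesis nd : is_nondegenerate C.

Lemma plus_minus_hom_span (X X' Y Y' : C) (m : mor (plus_minus X Y) (plus_minus X' Y')) :
  exists n (a : 'I_n -> mor X X') (b : 'I_n -> mor Y Y'), m = \sum_i plus_minusm (a i) (b i).
Proof.
have [Phi [phi [phi_nat eqv]]] := nd.
have [w wE] := equivalence_full eqv ((phi X' Y')⁻¹ ∘ m ∘ phi X Y).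
have [n [a [b E]]] := dbox_hom_span w; exists n, a, b.
apply: (iso_epi (i := phi X Y)); rewrite comp_suml.
under eq_bigr do rewrite -phi_nat.
rewrite -comp_sumr -(linear_pred_sum (@fmap_lin _ _ _ Phi _ _)) -E wE.
by rewrite (compAl (bwdK _)) comp1f.
Qed.

(** This reduces statements about morphisms out of an arbitrary [Z] to the objects ι₊(P) ⊗ ι₋(Q). *)
Lemma plus_minus_span (Z : centre C) :
  exists n (P Q : 'I_n -> C) (u : forall i, mor (plus_minus (P i) (Q i)) Z)
    (v : forall i, mor Z (plus_minus (P i) (Q i))), \sum_i u i ∘ v i = mid Z.
Proof.
have [Phi [phi [phi_nat [G [eta [eps _]]]]]] := nd.
have [u [v E]] := dob_span (G Z).
exists (dn (G Z)), (@dl _ _ _ (G Z)), (@dr _ _ _ (G Z)).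
exists (fun i => eps Z ∘ fmap Phi (u i) ∘ (phi _ _)⁻¹).
exists (fun i => phi _ _ ∘ fmap Phi (v i) ∘ (eps Z)⁻¹).
apply: (iso_epi (i := eps Z)); rewrite comp1f comp_suml.
transitivity (eps Z ∘ fmap Phi (\sum_i u i ∘ v i)); last by rewrite E fmap_id compf1.
rewrite (linear_pred_sum (@fmap_lin _ _ _ Phi _ _)) comp_sumr.
apply: eq_bigr => i _; rewrite !compA fwdK compf1 (compAl (fwdK _)) comp1f.
by rewrite fmap_comp.
Qed.
End Nondegenerate.

(** * Duals of ι₊(X) in the centre *)

Lemma braid_unitl (k : fieldType) (C : braided k) (X : C) :
  ρ X ∘ braid 𝟙 X = λ X :> mor (𝟙 ⊗ X) X.
Proof. by rewrite -(hb_unit (minus_hb X)) /= compA fwdK compf1. Qed.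

Section PlusDual.
Variables (k : fieldType) (C : braided k).

(** The second hexagon makes ι₊ monoidal, so it carries the duality of C into the centre. *)
Lemma plus_tens_hb (X Y W : C) :
  tens_hb (zplus X) (zplus Y) W = braid (X ⊗ Y) W :> mor _ _.
Proof.
rewrite tens_hbE.
have := hexagon2 X Y W.
move=> /(congr1 (fun h => α W X Y ∘ h ∘ α X Y W)); rewrite !compA.
by rewrite (compAl (bwdK _)) comp1f fwdK compf1.
Qed.
Lemma unit_hb_braid (W : C) : unit_hb W = braid 𝟙 W :> mor _ _.
Proof. by rewrite /= -braid_unitl (compAl (fwdK _)) comp1f. Qed.

Variable D : rigid C.
Notation "X ^∨" := (ldual D X) (at level 2, format "X ^∨").

Fact zev_compat (X : C) :
  @hb_compat _ _ (ztens (zplus X^∨) (zplus X)) (zunit C) (ev D X).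
Proof.
move=> W; rewrite [fwd (zhb (ztens _ _) W)]plus_tens_hb [fwd (zhb _ W)]unit_hb_braid.
exact: braid_nat.
Qed.
Fact zcoev_compat (X : C) :
  @hb_compat _ _ (zunit C) (ztens (zplus X) (zplus X^∨)) (coev D X).
Proof.
move=> W; rewrite [fwd (zhb (ztens _ _) W)]plus_tens_hb [fwd (zhb _ W)]unit_hb_braid.
exact: braid_nat.
Qed.
Definition zev (X : C) : @mor _ (centre C) (iota_plus C X^∨ ⊗ iota_plus C X) 𝟙 :=
  zmk (@zev_compat X).
Definition zcoev (X : C) : @mor _ (centre C) 𝟙 (iota_plus C X ⊗ iota_plus C X^∨) :=
  zmk (@zcoev_compat X).
Lemma plus_dual (X : C) : left_dual_axioms (zev X) (zcoev X).
Proof. by case: (dual_axioms D X) => d1 d2; split; apply: zval_inj. Qed.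
End PlusDual.

(** * The right adjoint ι₊(-) ⊗ Rt of the forgetful functor *)

Section Adjunction.
Variables (k : fieldType) (C : braided k) (D : rigid C).
Notation "X ^∨" := (ldual D X) (at level 2, format "X ^∨").
Notation F := (forget C).
Hypotheses (ss : is_semisimple C) (nd : is_nondegenerate C).
Variables (Rt : centre C) (j : forall Y : C, mor (dpm D Y Y) Rt).
Hypothesis coend : is_coend (fun X X' Y Y' f g => @dpmm _ _ D X X' Y Y' f g) j.

Lemma plus_minusm_comp (X X' X'' Y Y' Y'' : C) (f' : mor X' X'') (f : mor X X')
    (g' : mor Y' Y'') (g : mor Y Y') :
  plus_minusm f' g' ∘ plus_minusm f g = plus_minusm (f' ∘ f) (g' ∘ g).
Proof. by rewrite /plus_minusm -tmor_comp -!fmap_comp. Qed.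

(* By the splitting of [Rt] and the fullness of C ⊠ C -> Z(C), every such [g] is
   a sum of maps [j T ∘ (a ⊗ b)], and dinaturality moves [b] to the other leg. *)
Lemma hom_coend (P Q : C) (g : mor (plus_minus P Q) Rt) :
  exists h : mor P Q^∨, g = j Q ∘ (plus_minusm h (mid Q) : mor _ (dpm D Q Q)).
Proof.
have [n [T [t sum1]]] := coend_split ss coend.
have plus_linl : linear (fun h : mor P Q^∨ =>
    j Q ∘ (plus_minusm h (mid Q) : mor _ (dpm D Q Q))).
  by move=> a h h'; rewrite /plus_minusm fmap_lin tmor_linl comp_linr.
(* Morphisms of the required form are closed under finite sums. *)
have H (I : finType) (f : I -> mor (plus_minus P Q) Rt) :
    (forall i, exists h, f i = j Q ∘ (plus_minusm h (mid Q) : mor _ (dpm D Q Q))) ->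
    exists h, \sum_i f i = j Q ∘ (plus_minusm h (mid Q) : mor _ (dpm D Q Q)).
  move=> /choice[h hE]; exists (\sum_i h i).
  by rewrite (linear_pred_sum plus_linl); apply: eq_bigr.
rewrite -[g]comp1f -sum1 comp_suml; apply: (@H) => i.
have [m [a [b E]]] := plus_minus_hom_span nd (t i ∘ g : mor _ (plus_minus _ _)).
rewrite compA E comp_sumr; apply: (@H) => l; exists (dualm D (b l) ∘ a l).
have -> : plus_minusm (a l) (b l) =
    dpmm D (mid (T i)) (b l) ∘ (plus_minusm (a l) (mid Q) : mor _ (dpm D (T i) Q)).
  rewrite -[dpmm _ _ _]/(plus_minusm (dualm D (mid (T i))) (b l)) dualm_id.
  by rewrite plus_minusm_comp comp1f compf1.
rewrite (compAl (esym (proj1 coend _ _ (b l)))) compA; congr (_ ∘ _).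
rewrite -[dpmm _ _ _]/(plus_minusm (dualm D (b l)) (mid Q)).
by rewrite plus_minusm_comp comp1f.
Qed.

Section Counit.
Variable e : mor (F Rt) 𝟙.
Hypothesis eE : forall Y, e ∘ fmap F (j Y) = ev D Y.

Lemma counit_coend_plus (P Q : C) (h : mor P Q^∨) :
  e ∘ fmap F (j Q ∘ (plus_minusm h (mid Q) : mor _ (dpm D Q Q))) = ev D Q ∘ (h ▷ Q).
Proof. by rewrite -eE compA. Qed.

(** On ι₊(P) ⊗ ι₋(Q), a map to [𝟙] corresponds to some P → Q^∨, which [j Q] turns into a map to
    [Rt]. *)
Lemma counit_coend_surj (Z : centre C) (h : mor (F Z) 𝟙) : exists g, e ∘ fmap F g = h.
Proof.
have [n [P [Q [u [v sum1]]]]] := plus_minus_span nd Z.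
have H i : exists g : mor (plus_minus (P i) (Q i)) Rt, e ∘ fmap F g = h ∘ fmap F (u i).
  have [g gE] := ev_surj D (h ∘ fmap F (u i) : mor (P i ⊗ Q i) 𝟙).
  exists (j (Q i) ∘ (plus_minusm g (mid (Q i)) : mor _ (dpm D (Q i) (Q i)))).
  by rewrite counit_coend_plus.
have [g gE] := fin_all_exists H; exists (\sum_i g i ∘ v i).
rewrite -[RHS]compf1 -(fmap_id F) -sum1.
rewrite !(linear_pred_sum (@fmap_lin _ _ _ F _ _)) !comp_sumr.
by apply: eq_bigr => i _; rewrite !fmap_comp (compAl (gE i)) compA.
Qed.

(** On ι₊(P) ⊗ ι₋(Q) both maps come from morphisms P → Q^∨ by [hom_coend], and evaluation separates
    these. *)
Lemma counit_coend_inj (Z : centre C) (g g' : mor Z Rt) :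
  e ∘ fmap F g = e ∘ fmap F g' -> g = g'.
Proof.
have [n [P [Q [u [v sum1]]]]] := plus_minus_span nd Z.
move=> E; rewrite -[g]compf1 -[g']compf1 -sum1 !comp_sumr; apply: eq_bigr => i _.
rewrite -!compA; congr (_ ∘ _).
have : e ∘ fmap F (g ∘ u i) = e ∘ fmap F (g' ∘ u i).
  by rewrite !fmap_comp -!compA E.
have [h ->] := hom_coend (g ∘ u i); have [h' ->] := hom_coend (g' ∘ u i).
by rewrite !counit_coend_plus => /ev_inj ->.
Qed.

Definition plus_counit (X : C) : mor (F (iota_plus C X ⊗ Rt)) X := ρ X ∘ (X ◁ e).

(** Moving [X] across by duality, in C and in the centre alike, reduces the adjunction at [X] to the
    bijection Hom(Z, Rt) ≅ Hom(F Z, 𝟙). *)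
Lemma plus_counit_ltr (X : C) (Z : centre C) (g : mor Z (iota_plus C X ⊗ Rt)) :
  ltr (ev D X) ((ρ X)⁻¹ ∘ plus_counit X ∘ fmap F g) =
  e ∘ fmap F (ltr (zev D X) g).
Proof.
by rewrite /plus_counit compA (compAl (fwdK _)) comp1f ltr_natr.
Qed.

Lemma plus_counit_inj (X : C) (Z : centre C) (g g' : mor Z (iota_plus C X ⊗ Rt)) :
  plus_counit X ∘ fmap F g = plus_counit X ∘ fmap F g' -> g = g'.
Proof.
move=> E; apply: (ltr_inj (plus_dual D X)); apply: counit_coend_inj.
by rewrite -!plus_counit_ltr E.
Qed.
Lemma plus_counit_surj (X : C) (Z : centre C) (f : mor (F Z) X) :
  exists g : mor Z (iota_plus C X ⊗ Rt), plus_counit X ∘ fmap F g = f.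
Proof.
have [h hE] := @counit_coend_surj (iota_plus C X^∨ ⊗ Z) (ltr (ev D X) ((ρ X)⁻¹ ∘ f)).
exists (luntr (zcoev D X) h); apply: (iso_mono (i := iso_sym (ρ X))).
apply: (ltr_inj (dual_axioms D X)).
by rewrite plus_counit_ltr (luntrK (plus_dual D X)) hE.
Qed.

Definition plus_transpose (Z : centre C) (X : C) (f : mor (F Z) X) :
  mor Z (iota_plus C X ⊗ Rt) := sval (cid (plus_counit_surj f)).

Fact plus_transposeK (Z : centre C) (X : C) (f : mor (F Z) X) :
  plus_counit X ∘ fmap F (plus_transpose f) = f.
Proof. exact: (svalP (cid (plus_counit_surj f))). Qed.
Fact plus_transpose_counit (Z : centre C) (X : C) (g : mor Z (iota_plus C X ⊗ Rt)) :
  plus_transpose (plus_counit X ∘ fmap F g) = g.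
Proof. by apply: plus_counit_inj; rewrite plus_transposeK. Qed.

Definition plus_adjoint : right_adjoint F (fun X : C => iota_plus C X ⊗ Rt) :=
  RightAdjoint plus_transposeK plus_transpose_counit.

Lemma plus_counitE (X Y : C) :
  counit plus_adjoint X ∘ (X ◁ fmap F (j Y)) = ρ X ∘ (X ◁ ev D Y).
Proof. by rewrite -eE wl_comp compA. Qed.
End Counit.
End Adjunction.

(** * The algebra structure on a terminal left central morphism *)

Section LeftCentreAlgebra.
Variables (k : fieldType) (D : braided k) (B : algebra D).
Notation μ := (alg_mul B).

Lemma left_central_comp (Y Y' : D) (y : mor Y B) (h : mor Y' Y) :
  left_central y -> left_central (y ∘ h).
Proof.
rewrite /left_central => yc; rewrite wr_comp wl_comp (compAl yc) !compA.
by rewrite braid_nat.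
Qed.

Lemma left_central_unit : left_central (alg_unit B).
Proof.
by rewrite /left_central alg_mul1l (compAl (alg_mul1r B)) braid_unitl.
Qed.

(** [B] passes the two factors [y] one at a time ([s1], [s4]); the second hexagon merges the two
    braidings. *)
Lemma left_central_mul (Y : D) (y : mor Y B) :
  left_central y -> left_central (μ ∘ (y ⊗₁ y)).
Proof.
move=> yc; rewrite /left_central wr_comp wl_comp (compAl (alg_mulA B)) !compA.
rewrite assoc_nat.
have s1 : (B ◁ μ) ∘ (y ⊗₁ (y ▷ B)) = (B ◁ μ) ∘ (y ⊗₁ (B ◁ y)) ∘ (Y ◁ braid Y B).
  by rewrite -!tmor_comp yc ?comp1f ?compf1.
rewrite (compAl s1) !compA.
have s2 : μ ∘ (B ◁ μ) = μ ∘ (μ ▷ B) ∘ (α B B B)⁻¹.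
  by rewrite -compA alg_mulA !compA bwdK compf1.
have s3 : (α B B B)⁻¹ ∘ (y ⊗₁ (B ◁ y)) = ((y ▷ B) ⊗₁ y) ∘ (α Y B Y)⁻¹.
  by apply/esym/iso_conj; rewrite assoc_nat.
rewrite (compAl s2) !compA (compAl s3) !compA.
have s4 : (μ ▷ B) ∘ ((y ▷ B) ⊗₁ y) = (μ ▷ B) ∘ ((B ◁ y) ⊗₁ y) ∘ (braid Y B ▷ Y).
  by rewrite -!tmor_comp yc ?comp1f ?compf1.
rewrite (compAl s4) !compA (compAl (alg_mulA B)) !compA (compAl (assoc_nat _ _ _)) !compA.
do 2 congr (_ ∘ _); congr (_ ∘ _).
have := hexagon2 Y Y B; move=> /(congr1 (fun h => α B Y Y ∘ h ∘ α Y Y B)).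
by rewrite !compA fwdK compf1 (compAl (bwdK _)) comp1f => ->.
Qed.

(** Product and unit are lifts along [y]. The algebra laws hold after composition with [y], which is
    cancellable by terminality. *)
Lemma left_centre_algebra (L : D) (y : mor L B) :
  left_central y ->
  (forall (Y : D) (y' : mor Y B), left_central y' -> exists! f : mor Y L, y ∘ f = y') ->
  exists (A : algebra D) (z : mor A B), is_left_centre z.
Proof.
move=> yc term.
have y_inj (Y : D) (f f' : mor Y L) : y ∘ f = y ∘ f' -> f = f'.
  move=> E; have [h [_ U]] := term _ _ (left_central_comp f' yc).
  by rewrite -(U f) // (U f').
have [m [mE _]] := term _ _ (left_central_mul yc).
have [u [uE _]] := term _ _ left_central_unit.
have mA : m ∘ (m ▷ L) = m ∘ (L ◁ m) ∘ α L L L.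
  apply: y_inj; rewrite !(compAl mE) !compA -tmor_comp mE compf1.
  rewrite (compAl (esym (tmor_comp _ _ _ _))) mE compf1.
  have -> : (μ ∘ (y ⊗₁ y)) ⊗₁ y = (μ ▷ B) ∘ ((y ⊗₁ y) ⊗₁ y).
    by rewrite -tmor_comp comp1f.
  have -> : y ⊗₁ (μ ∘ (y ⊗₁ y)) = (B ◁ μ) ∘ (y ⊗₁ (y ⊗₁ y)).
    by rewrite -tmor_comp comp1f.
  by rewrite (compAl (alg_mulA B)) !compA assoc_nat.
have m1l : m ∘ (u ▷ L) = λ L.
  apply: y_inj; rewrite (compAl mE) !compA -tmor_comp uE compf1.
  by rewrite tmorE (compAl (alg_mul1l B)) lunit_nat.
have m1r : m ∘ (L ◁ u) = ρ L.
  apply: y_inj; rewrite (compAl mE) !compA -tmor_comp uE compf1.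
  by rewrite tmorE' (compAl (alg_mul1r B)) runit_nat.
by exists (Algebra mA m1l m1r), y; split.
Qed.
End LeftCentreAlgebra.

(** * Kernels in the centre *)

Section CentreKernel.
Variables (k : fieldType) (C : braided k) (D : rigid C).
Notation "X ^∨" := (ldual D X) (at level 2, format "X ^∨").
Implicit Types X Y Z W V K : C.

(** X ⊗ - is right adjoint to X^∨ ⊗ -, hence preserves kernels; the braiding transfers this to - ⊗
    X. *)
Lemma wl_kernel X Z W K (d : mor Z W) (i : mor K Z) V (g : mor V (X ⊗ Z)) :
  is_kernel d i -> (X ◁ d) ∘ g = 0 -> exists h, (X ◁ i) ∘ h = g.
Proof.
move=> [_ lift] dg0.
have [|h [hE _]] := lift _ (ltr (ev D X) g).
  rewrite -ltr_natr dg0 /ltr.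
  by rewrite (linear_pred0 (tmor_linr _)) !compf0.
exists (luntr (coev D X) h).
by rewrite -luntr_natr hE (ltrK (dual_axioms D X)).
Qed.
Lemma wl_mono X Z K (i : mor K Z) : is_mono i -> is_mono (X ◁ i).
Proof.
move=> mi V g h E; apply: (ltr_inj (dual_axioms D X)); apply: mi.
by rewrite -!ltr_natr E.
Qed.
Lemma wr_kernel X Z W K (d : mor Z W) (i : mor K Z) V (g : mor V (Z ⊗ X)) :
  is_kernel d i -> (d ▷ X) ∘ g = 0 -> exists h, (i ▷ X) ∘ h = g.
Proof.
move=> ki dg0; have [|h hE] := @wl_kernel X _ _ _ _ _ _ (braid Z X ∘ g) ki.
  by rewrite -compA -braid_nat compA dg0 compf0.
exists ((braid K X)⁻¹ ∘ h); apply: (iso_mono (i := braid Z X)).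
by rewrite -compA braid_nat !compA (compAl (bwdK _)) comp1f hE.
Qed.
Lemma wr_mono X Z K (i : mor K Z) : is_mono i -> is_mono (i ▷ X).
Proof.
move=> mi V g h E; apply: (iso_mono (i := braid K X)); apply: (wl_mono mi).
by rewrite -!compA -braid_nat !compA E.
Qed.

Section Kernel.
Variables (Z W : centre C) (d : mor Z W) (K : C) (i : mor K (forget C Z)).
Hypothesis ki : is_kernel (fmap (forget C) d) i.

(** The half-braiding of [Z] and its inverse both restrict to the kernel, and the restrictions are
    inverse because tensoring keeps [i] mono. *)
Lemma kernel_hb_ex X : exists h : iso (K ⊗ X) (X ⊗ K),
  (X ◁ i) ∘ h = zhb Z X ∘ (i ▷ X).
Proof.
have mi := kernel_mono ki; have [di0 _] := ki.
have [|f fE] := @wl_kernel X _ _ _ _ _ _ (zhb Z X ∘ (i ▷ X)) ki.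
  rewrite -compA -(zvalP d) compA -wr_comp [zval d ∘ i]di0.
  by rewrite (linear_pred0 (tmor_linl _)) compf0.
have [|g gE] := @wr_kernel X _ _ _ _ _ _ ((zhb Z X)⁻¹ ∘ (X ◁ i)) ki.
  rewrite -compA (iso_conj (zvalP d X)) compA -wl_comp [zval d ∘ i]di0.
  by rewrite (linear_pred0 (tmor_linr _)) compf0.
have gf : g ∘ f = mid _.
  by apply: (wr_mono mi); rewrite (compAl gE) compA fE (compAl (fwdK _)) comp1f compf1.
have fg : f ∘ g = mid _.
  by apply: (wl_mono mi); rewrite (compAl fE) compA gE (compAl (bwdK _)) comp1f compf1.
by exists (Iso gf fg).
Qed.
Definition kernel_hbi X := sval (cid (kernel_hb_ex X)).
Lemma kernel_hbiE X : (X ◁ i) ∘ kernel_hbi X = zhb Z X ∘ (i ▷ X).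
Proof. exact: svalP (cid (kernel_hb_ex X)). Qed.

Fact kernel_hb_nat X Y (f : mor X Y) :
  kernel_hbi Y ∘ (K ◁ f) = (f ▷ K) ∘ kernel_hbi X.
Proof.
apply: (wl_mono (kernel_mono ki)).
rewrite (compAl (kernel_hbiE Y)) compA tmor_interchange -compA hb_nat compA.
by rewrite -kernel_hbiE (compAl (esym (tmor_interchange f i))) compA.
Qed.
Fact kernel_hb_tens X Y :
  α X Y K ∘ kernel_hbi (X ⊗ Y) ∘ α K X Y =
  (X ◁ kernel_hbi Y) ∘ α X K Y ∘ (kernel_hbi X ▷ Y).
Proof.
apply: (wl_mono (wl_mono (kernel_mono ki))).
rewrite (compAl (esym (assoc_natr _ _ i))) !compA (compAl (kernel_hbiE _)) !compA.
rewrite -assoc_natl -[LHS]compA -[LHS]compA [(_ ∘ _) ∘ α _ _ _]compA hb_tens.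
rewrite (compAl (p := (X ◁ zhb Z Y) ∘ (X ◁ (i ▷ Y)))); last first.
  by rewrite -!wl_comp kernel_hbiE.
rewrite !compA (compAl (esym (assoc_natm _ _ i))) !compA -!wr_comp.
by rewrite kernel_hbiE.
Qed.
Fact kernel_hb_unit : λ K ∘ kernel_hbi 𝟙 = ρ K.
Proof.
apply: (kernel_mono ki).
rewrite -runit_nat -(hb_unit (zhb Z)) compA -kernel_hbiE.
by rewrite (compAl (esym (lunit_nat i))) compA.
Qed.

Lemma centre_kernel_ob : exists (L : centre C) (y : mor L Z), is_kernel d y.
Proof.
pose L : centre C := ZOb (HalfBraiding kernel_hb_nat kernel_hb_unit kernel_hb_tens).
have yc : @hb_compat _ _ L Z i by move=> X; apply: esym; apply: kernel_hbiE.
have mi := kernel_mono ki.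
exists L, (zmk yc : @mor _ (centre C) L Z); split.
  by apply: zval_inj; apply: (proj1 ki).
move=> V g dg0; have [|h [hE _]] := proj2 ki _ (fmap (forget C) g).
  by rewrite -[LHS](fmap_comp (forget C)) dg0.
have hc : @hb_compat _ _ V L h.
  move=> X; apply: (wl_mono mi); rewrite (compAl (kernel_hbiE X)) compA -wr_comp hE.
  by rewrite [LHS]zvalP [RHS](compAl (esym (wl_comp _ _ _))) hE.
exists (zmk hc); split; first exact: zval_inj.
by move=> h' h'E; apply: zval_inj; apply: mi; rewrite [LHS]hE -h'E.
Qed.
End Kernel.

Lemma centre_kernel (ab : is_abelian C) (Z W : centre C) (d : mor Z W) :
  exists (L : centre C) (y : mor L Z), is_kernel d y.
Proof.
have [_ kerC _ _ _] := ab; have [K [i ki]] := kerC _ _ (fmap (forget C) d).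
exact: centre_kernel_ob ki.
Qed.
End CentreKernel.

(** * Comparison of the left centre of R(A) with the full centre of A *)

Lemma rtr0 (k : fieldType) (C : monoidal k) (X X' V W : C) (coev : mor 𝟙 (X ⊗ X')) :
  rtr coev (0 : mor (V ⊗ X) W) = 0.
Proof. by rewrite /rtr (linear_pred0 (tmor_linl _)) comp0f. Qed.

Section FullCentre.
Variables (k : fieldType) (C : braided k) (D : rigid C) (ab : is_abelian C).
Variables (R : C -> centre C) (adj : right_adjoint (forget C) R) (A : algebra C).
Notation F := (forget C).
Notation B := (radj_alg adj A).
Notation ε := (counit adj A).
Variable (s : mor A (F (R A))).
Hypothesis counit_s : ε ∘ s = mid A.

(** Under transposition, left centrality of [f] becomes the full centrality equation precomposed
    with [F Y ◁ ε], which [s] splits. *)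
Lemma left_full_central (Y : centre C) (f : mor Y B) :
  left_central f <-> full_central (ε ∘ fmap F f : mor (F Y) A).
Proof.
set ζ := ε ∘ fmap F f.
have E1 : ε ∘ fmap F (alg_mul B ∘ (f ▷ B)) = (alg_mul A ∘ (ζ ▷ A)) ∘ (F Y ◁ ε).
  rewrite fmap_comp (compAl (counit_mul adj A)) !compA; congr (_ ∘ _).
  rewrite -[fmap F (f ▷ _)]/(fmap F f ▷ F (R A)).
  by rewrite -!tmor_comp compf1 comp1f compf1.
have E2 : ε ∘ fmap F (alg_mul B ∘ (B ◁ f) ∘ braid Y B) =
    (alg_mul A ∘ (A ◁ ζ) ∘ zhb Y A) ∘ (F Y ◁ ε).
  rewrite !fmap_comp (compAl (counit_mul adj A)) !compA; congr (_ ∘ _).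
  rewrite -[fmap F (_ ◁ f)]/(F (R A) ◁ fmap F f).
  rewrite -[fmap F (fwd (braid Y B))]/(fwd (zhb Y (F (R A)))).
  rewrite (hb_nat (zhb Y) ε) (compAl (esym (tmor_comp _ _ _ _))) compf1.
  by rewrite (compAl (esym (tmor_comp _ _ _ _))) comp1f compf1.
split=> [fc|ζc]; last by apply: (@radj_inj _ _ _ adj); rewrite [LHS]E1 [RHS]E2 ζc.
have /(congr1 (fun h => h ∘ (F Y ◁ s))) :
    (alg_mul A ∘ (ζ ▷ A)) ∘ (F Y ◁ ε) = (alg_mul A ∘ (A ◁ ζ) ∘ zhb Y A) ∘ (F Y ◁ ε).
  by rewrite -E1 -E2 fc.
by rewrite !compA -wl_comp counit_s tmor_id !compf1.
Qed.

(* Centrality of [f] says that a map out of [F Y ⊗ A] vanishes; moving [A] to the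
   codomain by duality and transposing makes this linear in [f]. *)
Lemma left_central_kernel : exists (W : centre C) (d : mor B W),
  forall (Y : centre C) (f : mor Y B), left_central f <-> d ∘ f = 0.
Proof.
pose d0 : mor (F (R A) ⊗ A) A := alg_mul A ∘ (ε ▷ A) - alg_mul A ∘ (A ◁ ε) ∘ zhb (R A) A.
exists (R (A ⊗ ldual D A)), (transpose adj (rtr (coev D A) d0)) => Y f.
rewrite left_full_central.
have d0f : d0 ∘ (fmap F f ▷ A) =
    alg_mul A ∘ ((ε ∘ fmap F f) ▷ A) - alg_mul A ∘ (A ◁ (ε ∘ fmap F f)) ∘ zhb Y A.
  rewrite compBf !compA -wr_comp; congr (_ - _); congr (_ ∘ _).
  by rewrite [zhb (R A) A ∘ _](zvalP f) wl_comp !compA.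
have df : counit adj _ ∘ fmap F (transpose adj (rtr (coev D A) d0) ∘ f) =
    rtr (coev D A) (d0 ∘ (fmap F f ▷ A)).
  by rewrite fmap_comp (compAl (transposeK _ _)) rtr_natl.
split=> [fc|df0].
  apply: (@radj_inj _ _ _ adj); rewrite df d0f fc subrr rtr0.
  by rewrite -[LHS](compf0 _ (counit adj _)).
apply/eqP; rewrite -subr_eq0; apply/eqP; rewrite -d0f.
apply: (rtr_inj (dual_axioms D A)); rewrite -df df0 rtr0.
by rewrite -[RHS](compf0 _ (counit adj _)).
Qed.

Lemma left_centre_ex : exists (L : algebra (centre C)) (y : mor L B), is_left_centre y.
Proof.
have [W [d dP]] := left_central_kernel.
have [L [y [dy0 lift]]] := centre_kernel D ab d.
apply: (@left_centre_algebra _ _ _ L y); first exact/dP.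
by move=> Y f /dP; apply: lift.
Qed.

Lemma full_centre_of_left (L : algebra (centre C)) (y : mor L B) :
  is_left_centre y -> is_full_centre (ε ∘ fmap F y : mor (F L) A).
Proof.
move=> [yc term [ymul yone]]; split.
- exact/left_full_central.
- move=> Y η ηc.
  have ηE := transposeK adj η.
  have [|f [fE U]] := term Y (transpose adj η : mor Y B).
    by apply/left_full_central; rewrite ηE.
  exists f; split; first by rewrite -fE fmap_comp compA in ηE *.
  move=> g gE; apply: U; apply: (@radj_inj _ _ _ adj).
  by rewrite ηE fmap_comp -compA.
split.
  rewrite compA -[fmap F y ∘ _]/(fmap F (y ∘ alg_mul L)) ymul fmap_comp.
  by rewrite (compAl (counit_mul adj A)) !compA -tmor_comp.
rewrite compA -[fmap F y ∘ _]/(fmap F (y ∘ alg_unit L)) yone.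
exact: counit_one.
Qed.

(** Terminality on both sides gives inverse comparison maps; multiplicativity is checked after [y]
    and the counit. *)
Lemma full_left_centre_iso (Z L : algebra (centre C)) (ζ : mor (F Z) A) (y : mor L B) :
  is_full_centre ζ -> is_left_centre y ->
  exists φ : iso Z L, is_alg_hom φ /\ ε ∘ fmap F (y ∘ φ) = ζ.
Proof.
move=> [ζc ζterm [ζmul ζone]] yL.
have [yc yterm [ymul yone]] := yL.
have [ec eterm _] := full_centre_of_left yL.
have y_inj (Y : centre C) (f g : mor Y L) : y ∘ f = y ∘ g -> f = g.
  move=> E; have [h [_ U]] := yterm _ _ (left_central_comp g yc).
  by rewrite -(U f) // (U g).
have [f [fE _]] := eterm _ _ ζc; have [g [gE _]] := ζterm _ _ ec.
have fcomp : ε ∘ fmap F (y ∘ f) = ζ by rewrite -fE fmap_comp compA.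
have fg : f ∘ g = mid L.
  apply: y_inj; apply: (@radj_inj _ _ _ adj).
  by rewrite compf1 -compA fmap_comp -compA fcomp.
have gf : g ∘ f = mid Z.
  have [h [_ U]] := ζterm _ _ ζc.
  rewrite -(U (mid Z)) ?fmap_id ?compf1 //; apply: esym; apply: U.
  by rewrite fmap_comp -compA gE.
exists (Iso gf fg); split=> //; split; apply: y_inj; apply: (@radj_inj _ _ _ adj).
  rewrite -compA fmap_comp -compA fcomp [LHS]ζmul (compAl ymul).
  rewrite compA -tmor_comp fmap_comp (compAl (counit_mul adj A)) compA; congr (_ ∘ _).
  rewrite -[fmap F (_ ⊗₁ _)]/(fmap F (y ∘ f) ⊗₁ fmap F (y ∘ f)).
  by rewrite -tmor_comp fcomp.
by rewrite -compA fmap_comp -compA fcomp [LHS]ζone yone counit_one.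
Qed.
End FullCentre.

(* With [j 𝟙], this splits the counit of the adjunction. *)
Lemma ev_unit_split (k : fieldType) (C : monoidal k) (D : rigid C) :
  exists s : mor 𝟙 (ldual D 𝟙 ⊗ 𝟙), ev D 𝟙 ∘ s = mid 𝟙.
Proof.
have [E _] := dual_axioms D 𝟙.
exists (λ _ ∘ α _ _ _ ∘ (coev D 𝟙 ▷ 𝟙) ∘ (λ 𝟙)⁻¹).
by rewrite (compAl (esym (lunit_nat _))) !compA {1}lunit_unit -[RHS](bwdK (λ 𝟙)) -E !compA.
Qed.


(* Rt is the coend of ι₊(Y^∨) ⊗ ι₋(Y).  The functor X |-> ι₊(X) ⊗ Rt is right
   adjoint to the forgetful functor, with the counit induced by the evaluations
   (hence uniquely determined), and radj_alg R A is the resulting algebra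
   structure on ι₊(A) ⊗ Rt. *)
Theorem mainTheorem4 (k : fieldType) (C : modular k) (A : algebra C)
    (Rt : centre C)
    (j : forall Y : C,
       mor (iota_plus C (ldual (mod_rigid C) Y) ⊗ iota_minus C Y) Rt)
    (Rt_coend : is_Rtilde j) :
  exists R : right_adjoint (forget C) (fun X : C => iota_plus C X ⊗ Rt),
    (forall X Y : C,
       counit R X ∘ (X ◁ fmap (forget C) (j Y)) =
       ρ X ∘ (X ◁ ev (mod_rigid C) Y)) /\
    [/\ exists (Z : algebra (centre C)) (zeta : mor (forget C Z) A),
          is_full_centre zeta,
        exists (L : algebra (centre C)) (y : mor L (radj_alg R A)),
          is_left_centre y
      & forall (Z : algebra (centre C)) (zeta : mor (forget C Z) A)
          (L : algebra (centre C)) (y : mor L (radj_alg R A)),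
        is_full_centre zeta -> is_left_centre y ->
        exists phi : iso Z L,
          is_alg_hom phi /\
          counit R A ∘ fmap (forget C) (y ∘ phi) = zeta].
Proof.
pose D := mod_rigid C; have ss := mod_semisimple C; have nd := mod_nondegenerate C.
have [e eE] := coend_ev_ex ss (Rt_coend : is_coend (@dpmm _ _ D) j).
pose R := plus_adjoint ss nd Rt_coend eE.
have RE : forall X Y : C, counit R X ∘ (X ◁ fmap (forget C) (j Y)) = ρ X ∘ (X ◁ ev D Y).
  exact: plus_counitE.
have [t tE] := ev_unit_split D.
(* The section of the counit passes through the component of the coend at [𝟙]. *)
have sE : counit R A ∘ ((A ◁ fmap (forget C) (j 𝟙)) ∘ (A ◁ t) ∘ (ρ A)⁻¹) = mid A.
  by rewrite (compAl (RE A 𝟙)) compA (compAl (esym (wl_comp _ _ _))) tE tmor_id comp1f bwdK.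
have [ab _ _] := ss.
have [L [y yL]] := left_centre_ex D ab sE.
exists R; split=> //; split.
- by exists L, (counit R A ∘ fmap (forget C) y); exact (full_centre_of_left sE yL).
- by exists L, y.
by move=> Z zeta L' y' hZ hL; exact (full_left_centre_iso sE hZ hL).
Qed.
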